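(* Let $\Bbbk$ be a field of characteristic zero. For a pre-Lie algebra $L$ over $\Bbbk$, let $U_{\mathrm{PreLie}}(L)$ denote its universal multiplicative enveloping algebra. Then there is a vector space isomorphism $$U_{\mathrm{PreLie}}(L)\cong T(L)\otimes S(L),$$ where $T(L)=\bigoplus_{n\ge 0}L^{\otimes n}$ and $S(L)=\bigoplus_{n\ge 0}S^n(L)$ are the underlying vector spaces of the tensor algebra and the symmetric algebra of the vector space $L$. Moreover, these isomorphisms can be chosen in a way that is natural with respect to pre-Lie algebra morphisms, i.e. the functors $L\mapsto U_{\mathrm{PreLie}}(L)$ and $L\mapsto T(L)\otimes S(L)$ from pre-Lie algebras to vector spaces are naturally isomorphic.
   Context: A pre-Lie (right-symmetric) algebra is a vector space $L$ with a bilinear operation $\triangleleft$ satisfying $(a_1\triangleleft a_2)\triangleleft a_3 - a_1\triangleleft (a_2\triangleleft a_3)=(a_1\triangleleft a_3)\triangleleft a_2 - a_1\triangleleft (a_3\triangleleft a_2)$. A (operadic) module over $L$ is a vector space $E$ with bilinear maps $L\times E\to E$, $(a,e)\mapsto a\triangleleft e$, and $E\times L\to E$, $(e,a)\mapsto e\triangleleft a$, such that $L\oplus E$, with the product extending that of $L$ by these maps and by $E\triangleleft E=0$, is a pre-Lie algebra. The universal multiplicative enveloping algebra $U_{\mathrm{PreLie}}(L)$ is the unital associative algebra whose category of left modules is equivalent (compatibly with underlying vector spaces) to the category of $L$-modules. Explicitly, it is generated by symbols $l_a,r_a$ depending linearly on $a\in L$ (acting on a module by $l_a(e)=a\triangleleft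 e$, $r_a(e)=e\triangleleft a$), subject to the relations $r_br_a-r_{a\triangleleft b}=r_ar_b-r_{b\triangleleft a}$ and $r_bl_a-l_ar_b=l_{a\triangleleft b}-l_al_b$ for all $a,b\in L$. A morphism $f\colon L\to L'$ induces the algebra morphism $l_a\mapsto l_{f(a)}$, $r_a\mapsto r_{f(a)}$. *)

(* Defs.v *)
From HB Require Import structures.
From mathcomp Require Import all_boot all_order all_algebra all_fingroup.
From mathcomp Require Import generic_quotient ring_quotient finmap.
From mathcomp Require Import boolp.
From mathcomp.multinomials Require Import monalg.

Set Implicit Arguments.
Unset Strict Implicit.
Unset Printing Implicit Defensive.

Import GRing.Theory.
Local Open Scope ring_scope.
Local Open Scope quotient_scope.

Record subspace (k : fieldType) (V : lmodType k) := Subspace {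
  subspace_pred :> {pred V};
  subspace_closed : submod_closed subspace_pred
}.

HB.instance Definition _ (k : fieldType) (V : lmodType k) (S : subspace V) :=
  GRing.isZmodClosed.Build V (subspace_pred S)
    (GRing.submod_closedB (subspace_closed S)).

Definition subspace_zmod (k : fieldType) (V : lmodType k) (S : subspace V) :
  zmodClosed V := GRing.ZmodClosed.clone V (subspace_pred S) _.

Section LmodQuotient.
Variables (k : fieldType) (V : lmodType k) (S : subspace V).

Definition lquot := Quotient.quot (subspace_zmod S).

HB.instance Definition _ := GRing.Zmodule.on lquot.

Definition lproj (v : V) : lquot := \pi_(Quotient.quot (subspace_zmod S)) v.

Lemma lproj_surj (x : lquot) : exists v, x = lproj v.
Proof. by exists (repr x); rewrite /lproj reprK. Qed.

Lemma lproj_eq (u v : V) : lproj u = lproj v <-> u - v \in S.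
Proof.
rewrite /lproj; split=> [e|h]; first by rewrite Quotient.idealrBE; apply/eqP.
by apply/eqP; rewrite -Quotient.idealrBE.
Qed.

Fact lproj_is_zmod_morphism : zmod_morphism lproj.
Proof. by move=> u v; rewrite /lproj raddfB. Qed.

HB.instance Definition _ :=
  GRing.isZmodMorphism.Build V lquot lproj lproj_is_zmod_morphism.

Definition lquot_scale (c : k) (x : lquot) : lquot :=
  lproj (c *: repr (x : Quotient.quot (subspace_zmod S))).

Lemma lquot_scaleE c v : lquot_scale c (lproj v) = lproj (c *: v).
Proof.
apply/lproj_eq; rewrite -scalerBr -[_ *: _]addr0; case: (subspace_closed S) => S0; apply=> //.
by apply/lproj_eq; rewrite /lproj reprK.
Qed.

Fact lquot_scaleA a b x :
  lquot_scale a (lquot_scale b x) = lquot_scale (a * b) x.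
Proof. by have [v ->] := lproj_surj x; rewrite !lquot_scaleE scalerA. Qed.

Fact lquot_scale1 : left_id 1 lquot_scale.
Proof.
by move=> x; have [v ->] := lproj_surj x; rewrite lquot_scaleE scale1r.
Qed.

Fact lquot_scaleDr : right_distributive lquot_scale +%R.
Proof.
move=> c x y; have [u ->] := lproj_surj x; have [v ->] := lproj_surj y.
by rewrite -raddfD !lquot_scaleE scalerDr raddfD.
Qed.

Fact lquot_scaleDl x : {morph lquot_scale^~ x : a b / a + b}.
Proof.
move=> a b; have [v ->] := lproj_surj x.
by rewrite !lquot_scaleE scalerDl raddfD.
Qed.

HB.instance Definition _ := GRing.Zmodule_isLmodule.Build k lquot
  lquot_scaleA lquot_scale1 lquot_scaleDr lquot_scaleDl.

Fact lproj_is_scalable : scalable lproj.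
Proof. by move=> c v; rewrite -lquot_scaleE. Qed.

HB.instance Definition _ :=
  GRing.isScalable.Build k V lquot *:%R lproj lproj_is_scalable.

Section Lift.
Variables (W : lmodType k) (f : {linear V -> W}).
Hypothesis fS : forall v, v \in S -> f v = 0.

Definition lquot_lift_fun of (forall v, v \in S -> f v = 0) :=
  fun x : lquot => f (repr (x : Quotient.quot (subspace_zmod S))).

Lemma lquot_lift_funE v : lquot_lift_fun fS (lproj v) = f v.
Proof.
apply/eqP; rewrite -subr_eq0 /lquot_lift_fun -raddfB; apply/eqP/fS.
by apply/lproj_eq; rewrite /lproj reprK.
Qed.

Fact lquot_lift_is_linear : linear (lquot_lift_fun fS).
Proof.
move=> c x y; have [u ->] := lproj_surj x; have [v ->] := lproj_surj y.
by rewrite -linearP !lquot_lift_funE linearP.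
Qed.

HB.instance Definition _ := GRing.isLinear.Build k lquot W *:%R
  (lquot_lift_fun fS) lquot_lift_is_linear.

Definition lquot_lift : {linear lquot -> W} := lquot_lift_fun fS.

Lemma lquot_liftE v : lquot_lift (lproj v) = f v.
Proof. exact: lquot_lift_funE. Qed.

End Lift.
End LmodQuotient.

Section Span.
Variables (k : fieldType) (V : lmodType k) (R : V -> Prop).

Inductive in_span : V -> Prop :=
| in_span_gen v : R v -> in_span v
| in_span0 : in_span 0
| in_spanP c u v : in_span u -> in_span v -> in_span (c *: u + v).

Fact in_span_submod_closed : submod_closed [pred v | `[< in_span v >]].
Proof.
split=> [|c u v]; rewrite !inE; first by apply/asboolP/in_span0.
by move=> /asboolP hu /asboolP hv; apply/asboolP/in_spanP.
Qed.

Definition lspan : subspace V := Subspace in_span_submod_closed.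

Lemma lspan_gen v : R v -> v \in lspan.
Proof. by move=> Rv; rewrite inE; apply/asboolP/in_span_gen. Qed.

Lemma lspan_kill (W : lmodType k) (f : {linear V -> W}) :
  (forall v, R v -> f v = 0) -> forall v, v \in lspan -> f v = 0.
Proof.
move=> fR v; rewrite inE => /asboolP; elim=> {v} [v /fR//||c u v _ hu _ hv].
  exact: linear0.
by rewrite linearP hu hv scaler0 addr0.
Qed.

End Span.

Section FreeLift.
Variables (k : fieldType) (X : choiceType) (W : lmodType k) (h : X -> W).

(* {malg k[X]} is the vector space with basis X, and << x >> its basis       *)
(* vector at x.                                                              *)
Definition free_lift_fun (g : {malg k[X]}) : W :=
  \sum_(x <- msupp g) g@_x *: h x.

Lemma free_lift_funEw (d : {fset X}) g : (msupp g `<=` d)%fset ->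
  free_lift_fun g = \sum_(x <- d) g@_x *: h x.
Proof.
move=> le; rewrite /free_lift_fun (big_fset_incl _ le) //= => x _ xg.
by rewrite mcoeff_outdom // scale0r.
Qed.

Fact free_lift_is_linear : linear free_lift_fun.
Proof.
move=> c g1 g2; pose d := (msupp (c *: g1 + g2) `|` msupp g1 `|` msupp g2)%fset.
rewrite !(@free_lift_funEw d) ?fsubsetUr //; first last.
- by rewrite /d -fsetUA fsubsetUl.
- by rewrite /d fsetUAC fsubsetUr.
rewrite scaler_sumr -big_split /=; apply: eq_bigr => x _.
by rewrite mcoeffD mcoeffZ scalerDl scalerA.
Qed.

HB.instance Definition _ := GRing.isLinear.Build k {malg k[X]} W *:%R
  free_lift_fun free_lift_is_linear.

Definition free_lift : {linear {malg k[X]} -> W} := free_lift_fun.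

Lemma free_liftU x : free_lift << x >> = h x.
Proof.
rewrite /free_lift /= (@free_lift_funEw [fset x]%fset) ?msuppU_le //.
by rewrite big_seq_fset1 mcoeffUU scale1r.
Qed.

End FreeLift.

Section Tensor.
Variables (k : fieldType) (V W : lmodType k).

Inductive tens_rel : {malg k[(V * W)%type]} -> Prop :=
| tens_relPl c v1 v2 w :
    tens_rel (<< (c *: v1 + v2, w) >> - (c *: << (v1, w) >> + << (v2, w) >>))
| tens_relPr c v w1 w2 :
    tens_rel (<< (v, c *: w1 + w2) >> - (c *: << (v, w1) >> + << (v, w2) >>)).

Definition tens := lquot (lspan tens_rel).
HB.instance Definition _ := GRing.Lmodule.on tens.

Definition tpure (v : V) (w : W) : tens := lproj (lspan tens_rel) << (v, w) >>.

Lemma tpurePl c v1 v2 w :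
  tpure (c *: v1 + v2) w = c *: tpure v1 w + tpure v2 w.
Proof. by rewrite /tpure -linearP; apply/lproj_eq/lspan_gen/tens_relPl. Qed.

Lemma tpurePr c v w1 w2 :
  tpure v (c *: w1 + w2) = c *: tpure v w1 + tpure v w2.
Proof. by rewrite /tpure -linearP; apply/lproj_eq/lspan_gen/tens_relPr. Qed.

Section Lift.
Variables (E : lmodType k) (h : V -> W -> E).
Hypothesis hl : forall w, linear (h^~ w).
Hypothesis hr : forall v, linear (h v).

Fact tens_lift_kill g : g \in lspan tens_rel ->
  free_lift (fun x : (V * W)%type => h x.1 x.2) g = 0.
Proof.
move: g; apply: lspan_kill => _ [c v1 v2 w|c v w1 w2];
by rewrite linearB linearP !free_liftU /= ?hl ?hr subrr.
Qed.

Definition tens_lift : {linear tens -> E} := lquot_lift tens_lift_kill.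

Lemma tens_liftE v w : tens_lift (tpure v w) = h v w.
Proof. by rewrite /tens_lift lquot_liftE free_liftU. Qed.

End Lift.
End Tensor.

Section TensorMap.
Variables (k : fieldType) (V V' W W' : lmodType k).
Variables (f : {linear V -> V'}) (g : {linear W -> W'}).

Fact tens_map_linearl w : linear (fun v => tpure (f v) (g w)).
Proof. by move=> c v1 v2; rewrite linearP tpurePl. Qed.

Fact tens_map_linearr v : linear (fun w => tpure (f v) (g w)).
Proof. by move=> c w1 w2; rewrite linearP tpurePr. Qed.

Definition tens_map : {linear tens V W -> tens V' W'} :=
  tens_lift tens_map_linearl tens_map_linearr.

Lemma tens_mapE v w : tens_map (tpure v w) = tpure (f v) (g w).
Proof. exact: tens_liftE. Qed.

End TensorMap.

Section TensorPower.
Variables (k : fieldType) (n : nat) (V : lmodType k).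

Definition subst_at (w : {ffun 'I_n -> V}) (i : 'I_n) (a : V) :
  {ffun 'I_n -> V} := [ffun j => if j == i then a else w j].

(* The n-th tensor power, presented by the n-fold multilinearity relations.  *)
Inductive tpow_rel : {malg k[{ffun 'I_n -> V}]} -> Prop :=
| tpow_relP w i c a b :
    tpow_rel (<< subst_at w i (c *: a + b) >>
              - (c *: << subst_at w i a >> + << subst_at w i b >>)).

Definition tpow := lquot (lspan tpow_rel).
HB.instance Definition _ := GRing.Lmodule.on tpow.

Definition pow_pure (w : {ffun 'I_n -> V}) : tpow := lproj (lspan tpow_rel) << w >>.

Lemma pow_pureP w i c a b :
  pow_pure (subst_at w i (c *: a + b))
  = c *: pow_pure (subst_at w i a) + pow_pure (subst_at w i b).
Proof. by rewrite /pow_pure -linearP; apply/lproj_eq/lspan_gen/tpow_relP. Qed.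

Section Lift.
Variables (E : lmodType k) (h : {ffun 'I_n -> V} -> E).
Hypothesis hlin : forall w i, linear (fun a => h (subst_at w i a)).

Fact tpow_lift_kill g : g \in lspan tpow_rel -> free_lift h g = 0.
Proof.
move: g; apply: lspan_kill => _ [w i c a b].
by rewrite linearB linearP !free_liftU /= hlin subrr.
Qed.

Definition tpow_lift : {linear tpow -> E} := lquot_lift tpow_lift_kill.

Lemma tpow_liftE w : tpow_lift (pow_pure w) = h w.
Proof. by rewrite /tpow_lift lquot_liftE free_liftU. Qed.

End Lift.

(* S^n(V), as the coinvariants of the symmetric group acting on the n-th     *)
(* tensor power.                                                             *)
Inductive spow_rel : tpow -> Prop :=
| spow_relP (w : {ffun 'I_n -> V}) (s : 'S_n) :
    spow_rel (pow_pure [ffun j => w (s j)] - pow_pure w).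

Definition spow := lquot (lspan spow_rel).
HB.instance Definition _ := GRing.Lmodule.on spow.

Definition spow_pure (w : {ffun 'I_n -> V}) : spow :=
  lproj (lspan spow_rel) (pow_pure w).

Section SymLift.
Variables (E : lmodType k) (h : {ffun 'I_n -> V} -> E).
Hypothesis hlin : forall w i, linear (fun a => h (subst_at w i a)).
Hypothesis hsym : forall (w : {ffun 'I_n -> V}) (s : 'S_n), h [ffun j => w (s j)] = h w.

Fact spow_lift_kill g : g \in lspan spow_rel -> tpow_lift hlin g = 0.
Proof.
move: g; apply: lspan_kill => _ [w s].
by rewrite linearB !tpow_liftE hsym subrr.
Qed.

Definition spow_lift : {linear spow -> E} := lquot_lift spow_lift_kill.

Lemma spow_liftE w : spow_lift (spow_pure w) = h w.
Proof. by rewrite /spow_lift lquot_liftE tpow_liftE. Qed.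

End SymLift.
End TensorPower.

Section TensorPowerMap.
Variables (k : fieldType) (n : nat) (V V' : lmodType k) (f : {linear V -> V'}).

Definition map_word (w : {ffun 'I_n -> V}) : {ffun 'I_n -> V'} :=
  [ffun j => f (w j)].

Lemma map_word_subst w i a :
  map_word (subst_at w i a) = subst_at (map_word w) i (f a).
Proof. by apply/ffunP=> j; rewrite !ffunE; case: eqP. Qed.

Fact tpow_map_multilinear w i :
  linear (fun a => pow_pure (map_word (subst_at w i a))).
Proof. by move=> c a b; rewrite !map_word_subst linearP pow_pureP. Qed.

Definition tpow_map : {linear tpow n V -> tpow n V'} :=
  tpow_lift (h := fun w => pow_pure (map_word w)) tpow_map_multilinear.

Lemma tpow_mapE w : tpow_map (pow_pure w) = pow_pure (map_word w).
Proof. exact: tpow_liftE. Qed.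

Fact spow_map_multilinear w i :
  linear (fun a => spow_pure (map_word (subst_at w i a))).
Proof.
by move=> c a b; rewrite !map_word_subst linearP /spow_pure pow_pureP linearP.
Qed.

Fact spow_map_sym (w : {ffun 'I_n -> V}) (s : 'S_n) :
  spow_pure (map_word [ffun j => w (s j)]) = spow_pure (map_word w).
Proof.
have -> : map_word [ffun j => w (s j)] = [ffun j => map_word w (s j)].
  by apply/ffunP=> j; rewrite !ffunE.
by apply/lproj_eq/lspan_gen/spow_relP.
Qed.

Definition spow_map : {linear spow n V -> spow n V'} :=
  spow_lift (h := fun w => spow_pure (map_word w))
    spow_map_multilinear spow_map_sym.

Lemma spow_mapE w : spow_map (spow_pure w) = spow_pure (map_word w).
Proof. exact: spow_liftE. Qed.

End TensorPowerMap.

Section DirectSum.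
Variables (k : fieldType) (V : nat -> lmodType k).

Record dsum := DSum {
  dsum_val :> forall n, V n;
  dsum_fin : exists N, forall n, (N <= n)%N -> dsum_val n = 0
}.

HB.instance Definition _ := gen_eqMixin dsum.
HB.instance Definition _ := gen_choiceMixin dsum.

Lemma dsumP (x y : dsum) : (forall n, x n = y n) -> x = y.
Proof.
case: x y => [x hx] [y hy] /= h.
have e : x = y by exact: functional_extensionality_dep.
by subst y; congr DSum; exact: Prop_irrelevance.
Qed.

Fact dsum0_fin : exists N, forall n, (N <= n)%N -> (fun n => 0 : V n) n = 0.
Proof. by exists 0%N. Qed.

Fact dsumD_fin (x y : dsum) :
  exists N, forall n, (N <= n)%N -> (fun n => x n + y n) n = 0.
Proof.
have [[N hN] [M hM]] := (dsum_fin x, dsum_fin y); exists (maxn N M) => n.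
by rewrite geq_max => /andP[/hN -> /hM ->]; rewrite addr0.
Qed.

Fact dsumZ_fin (c : k) (x : dsum) :
  exists N, forall n, (N <= n)%N -> (fun n => c *: x n) n = 0.
Proof. by have [N hN] := dsum_fin x; exists N => n /hN ->; rewrite scaler0. Qed.

Definition dsum0 := DSum dsum0_fin.
Definition dsumD x y := DSum (dsumD_fin x y).
Definition dsumZ c x := DSum (dsumZ_fin c x).

Fact dsumDA : associative dsumD.
Proof. by move=> x y z; apply: dsumP => n /=; rewrite addrA. Qed.
Fact dsumDC : commutative dsumD.
Proof. by move=> x y; apply: dsumP => n /=; rewrite addrC. Qed.
Fact dsum0D : left_id dsum0 dsumD.
Proof. by move=> x; apply: dsumP => n /=; rewrite add0r. Qed.
Fact dsumND : left_inverse dsum0 (dsumZ (-1)) dsumD.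
Proof. by move=> x; apply: dsumP => n /=; rewrite scaleN1r addNr. Qed.

HB.instance Definition _ :=
  GRing.isZmodule.Build dsum dsumDA dsumDC dsum0D dsumND.

Fact dsumZA a b x : dsumZ a (dsumZ b x) = dsumZ (a * b) x.
Proof. by apply: dsumP => n /=; rewrite scalerA. Qed.
Fact dsumZ1 : left_id 1 dsumZ.
Proof. by move=> x; apply: dsumP => n /=; rewrite scale1r. Qed.
Fact dsumZDr : right_distributive dsumZ +%R.
Proof. by move=> c x y; apply: dsumP => n /=; rewrite scalerDr. Qed.
Fact dsumZDl x : {morph dsumZ^~ x : a b / a + b}.
Proof. by move=> a b; apply: dsumP => n /=; rewrite scalerDl. Qed.

HB.instance Definition _ :=
  GRing.Zmodule_isLmodule.Build k dsum dsumZA dsumZ1 dsumZDr dsumZDl.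

End DirectSum.

Section DirectSumMap.
Variables (k : fieldType) (V W : nat -> lmodType k).
Variable f : forall n, {linear V n -> W n}.

Fact dsum_map_fin (x : dsum V) :
  exists N, forall n, (N <= n)%N -> (fun n => f n (x n)) n = 0.
Proof. by have [N hN] := dsum_fin x; exists N => n /hN ->; rewrite linear0. Qed.

Definition dsum_map_fun x : dsum W := DSum (dsum_map_fin x).

Fact dsum_map_is_linear : linear dsum_map_fun.
Proof. by move=> c x y; apply: dsumP => n /=; rewrite linearP. Qed.

HB.instance Definition _ := GRing.isLinear.Build k (dsum V) (dsum W) *:%R
  dsum_map_fun dsum_map_is_linear.

Definition dsum_map : {linear dsum V -> dsum W} := dsum_map_fun.

End DirectSumMap.

Definition Tmod (k : fieldType) (V : lmodType k) := dsum (fun n => tpow n V).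
Definition Smod (k : fieldType) (V : lmodType k) := dsum (fun n => spow n V).
HB.instance Definition _ (k : fieldType) (V : lmodType k) :=
  GRing.Lmodule.on (Tmod V).
HB.instance Definition _ (k : fieldType) (V : lmodType k) :=
  GRing.Lmodule.on (Smod V).

Definition Tmod_map (k : fieldType) (V V' : lmodType k)
  (f : {linear V -> V'}) : {linear Tmod V -> Tmod V'} :=
  dsum_map (fun n => tpow_map n f).
Definition Smod_map (k : fieldType) (V V' : lmodType k)
  (f : {linear V -> V'}) : {linear Smod V -> Smod V'} :=
  dsum_map (fun n => spow_map n f).

Fact malg_scaleAr (R : comRingType) (K : monomType) (c : R)
  (x y : {malg R[K]}) : c *: (x * y) = x * (c *: y).
Proof.
apply/malgP=> m; rewrite [LHS]mcoeffZ [X in _ * X]mcoeffMl.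
rewrite [RHS](mcoeffMlw m (fsubset_refl _) (msuppZ_le c y)) mulr_sumr.
apply: eq_bigr => i _; rewrite mulr_sumr; apply: eq_bigr => j _.
by rewrite [in RHS]mcoeffZ mulrnAr mulrCA.
Qed.

(* {malg k[{fmonom X}]}, the monoid algebra of the free monoid on X, is the  *)
(* free associative algebra on X. Its multiplication is locked only to keep   *)
(* unification from unfolding it, and likewise for Umul below.                *)
HB.lock Definition falg_mul (k : fieldType) (X : choiceType)
  (x y : {malg k[{fmonom X}]}) : {malg k[{fmonom X}]} := x * y.

Definition falg (k : fieldType) (X : choiceType) := {malg k[{fmonom X}]}.

Section FreeAlgebra.
Variables (k : fieldType) (X : choiceType).

HB.instance Definition _ := GRing.Lmodule.on (falg k X).

Local Notation M := {malg k[{fmonom X}]}.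

Fact falg_mulA : associative (@falg_mul k X).
Proof. by move=> x y z; rewrite falg_mul.unlock mulrA. Qed.
Fact falg_mul1l : left_id (1 : M) (@falg_mul k X).
Proof. by move=> x; rewrite falg_mul.unlock mul1r. Qed.
Fact falg_mul1r : right_id (1 : M) (@falg_mul k X).
Proof. by move=> x; rewrite falg_mul.unlock mulr1. Qed.
Fact falg_mulDl : left_distributive (@falg_mul k X) +%R.
Proof. by move=> x y z; rewrite falg_mul.unlock mulrDl. Qed.
Fact falg_mulDr : right_distributive (@falg_mul k X) +%R.
Proof. by move=> x y z; rewrite falg_mul.unlock mulrDr. Qed.
Fact falg_1neq0 : (1 : M) != 0.
Proof. exact: oner_neq0. Qed.

HB.instance Definition _ := GRing.Zmodule_isNzRing.Build (falg k X)
  falg_mulA falg_mul1l falg_mul1r falg_mulDl falg_mulDr falg_1neq0.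

Fact falg_scaleAl (c : k) (x y : M) :
  c *: falg_mul x y = falg_mul (c *: x) y.
Proof. by rewrite falg_mul.unlock scalerAl. Qed.

HB.instance Definition _ :=
  GRing.Lmodule_isLalgebra.Build k (falg k X) falg_scaleAl.

Fact falg_scaleAr (c : k) (x y : M) :
  c *: falg_mul x y = falg_mul x (c *: y).
Proof. by rewrite falg_mul.unlock malg_scaleAr. Qed.

HB.instance Definition _ :=
  GRing.Lalgebra_isAlgebra.Build k (falg k X) falg_scaleAr.

Definition fgen (x : X) : falg k X := (<< fmu x >> : M).

Section Lift.
Variables (A : algType k) (h : X -> A).

Definition word_val (m : {fmonom X}) : A := \prod_(x <- (m : seq X)) h x.

Fact word_val_mmorphism : mmorphism word_val.
Proof.
split=> [m1 m2|]; rewrite /word_val.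
  by rewrite fmM big_cat.
by rewrite fm1 big_nil.
Qed.

HB.instance Definition _ :=
  isMultiplicative.Build {fmonom X} A word_val word_val_mmorphism.

Definition falg_lift_fun (g : falg k X) : A :=
  mmap (in_alg A) word_val (g : M).

Fact falg_lift_is_linear : linear falg_lift_fun.
Proof.
move=> c x y; rewrite /falg_lift_fun.
by rewrite [LHS](mmapD (c *: (x : M)) (y : M)) mmapZ /= mulr_algl.
Qed.

Fact falg_lift_is_monoid_morphism : monoid_morphism falg_lift_fun.
Proof.
have [hM h1] : multiplicative (mmap (in_alg A) word_val : M -> A).
  apply: commr_mmap_is_multiplicative => g m m'.
  by rewrite /GRing.comm /= mulr_algl mulr_algr.
split=> [|x y]; first exact: h1.
have -> : x * y = falg_mul x y by [].
by rewrite falg_mul.unlock /falg_lift_fun hM.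
Qed.

HB.instance Definition _ := GRing.isLinear.Build k (falg k X) A *:%R
  falg_lift_fun falg_lift_is_linear.
HB.instance Definition _ := GRing.isMonoidMorphism.Build (falg k X) A
  falg_lift_fun falg_lift_is_monoid_morphism.

Definition falg_lift : {lrmorphism falg k X -> A} := falg_lift_fun.

Lemma falg_liftE x : falg_lift (fgen x) = h x.
Proof.
rewrite /falg_lift /= /falg_lift_fun mmapU /= scale1r mul1r.
by rewrite /word_val fmU big_seq1.
Qed.

End Lift.
End FreeAlgebra.

Section Ideal.
Variables (k : fieldType) (A : algType k) (R : A -> Prop).

Inductive in_ideal : A -> Prop :=
| in_ideal_gen x : R x -> in_ideal x
| in_ideal0 : in_ideal 0
| in_idealD x y : in_ideal x -> in_ideal y -> in_ideal (x + y)
| in_idealMl a x : in_ideal x -> in_ideal (a * x)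
| in_idealMr x a : in_ideal x -> in_ideal (x * a).

Fact in_ideal_submod_closed : submod_closed [pred x | `[< in_ideal x >]].
Proof.
split=> [|c x y]; rewrite !inE; first by apply/asboolP/in_ideal0.
move=> /asboolP hx /asboolP hy; apply/asboolP/in_idealD => //.
by rewrite -mulr_algl; apply: in_idealMl.
Qed.

Definition ideal : subspace A := Subspace in_ideal_submod_closed.

Lemma idealP x : reflect (in_ideal x) (x \in ideal).
Proof. by rewrite inE; apply: asboolP. Qed.

Lemma ideal_kill (B : algType k) (f : {lrmorphism A -> B}) :
  (forall x, R x -> f x = 0) -> forall x, x \in ideal -> f x = 0.
Proof.
move=> fR x /idealP; elim=> {x} [x /fR//||x y _ hx _ hy|a x _ hx|x a _ hx].
- exact: rmorph0.
- by rewrite rmorphD /= hx hy addr0.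
- by rewrite rmorphM /= hx mulr0.
- by rewrite rmorphM /= hx mul0r.
Qed.

End Ideal.

HB.mixin Record Lmodule_isPreLie (k : fieldType) L of GRing.Lmodule k L := {
  prelie : L -> L -> L;
  prelie_linearl : forall b, linear (prelie^~ b);
  prelie_linearr : forall a, linear (prelie a);
  prelie_right_sym : forall a1 a2 a3,
    prelie (prelie a1 a2) a3 - prelie a1 (prelie a2 a3)
    = prelie (prelie a1 a3) a2 - prelie a1 (prelie a3 a2)
}.

#[short(type="preLieType")]
HB.structure Definition PreLie (k : fieldType) :=
  {L of GRing.Lmodule k L & Lmodule_isPreLie k L}.

Record preLieHom (k : fieldType) (L L' : preLieType k) := PreLieHom {
  plhom_fun :> {linear L -> L'};
  plhomM : forall a b, plhom_fun (prelie a b) = prelie (plhom_fun a) (plhom_fun b)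
}.

Section LRMorph.
Variables (k : fieldType) (A B : algType k) (f : {lrmorphism A -> B}).

Fact lrmorph_rr x y z x' y' z' : f (x * y - z - (x' * y' - z'))
  = f x * f y - f z - (f x' * f y' - f z').
Proof. by rewrite 3!rmorphB 2!rmorphM. Qed.

Fact lrmorph_rl x y x' y' z s t : f (x * y - x' * y' - (z - s * t))
  = f x * f y - f x' * f y' - (f z - f s * f t).
Proof. by rewrite 3!rmorphB 3!rmorphM. Qed.

End LRMorph.

Section UPreLie.
Variables (k : fieldType) (L : preLieType k).

(* The letters inl a and inr a stand for l_a and r_a.                        *)
Local Notation F := (falg k (L + L)%type).
Local Notation l a := (fgen k (inl a : (L + L)%type)).
Local Notation r a := (fgen k (inr a : (L + L)%type)).

Inductive UPreLie_rel : F -> Prop :=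
| UPreLie_rel_l c a b : UPreLie_rel (l (c *: a + b) - (c *: l a + l b))
| UPreLie_rel_r c a b : UPreLie_rel (r (c *: a + b) - (c *: r a + r b))
| UPreLie_rel_rr a b :
    UPreLie_rel ((r b * r a - r (prelie a b)) - (r a * r b - r (prelie b a)))
| UPreLie_rel_rl a b :
    UPreLie_rel ((r b * l a - l a * r b) - (l (prelie a b) - l a * l b)).

Section Kill.
Variables (A : algType k) (hl hr : L -> A).
Hypothesis hl_linear : linear hl.
Hypothesis hr_linear : linear hr.
Hypothesis h_rr : forall a b,
  hr b * hr a - hr (prelie a b) = hr a * hr b - hr (prelie b a).
Hypothesis h_rl : forall a b,
  hr b * hl a - hl a * hr b = hl (prelie a b) - hl a * hl b.

Definition letter_val (x : (L + L)%type) : A :=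
  match x with inl a => hl a | inr a => hr a end.

Fact U_lift_kill x : x \in ideal UPreLie_rel -> falg_lift letter_val x = 0.
Proof.
move: x; apply: ideal_kill => _ [c a b|c a b|a b|a b].
- by rewrite linearB linearP /= !falg_liftE /= hl_linear subrr.
- by rewrite linearB linearP /= !falg_liftE /= hr_linear subrr.
- by rewrite lrmorph_rr !falg_liftE /= h_rr subrr.
- by rewrite lrmorph_rl !falg_liftE /= h_rl subrr.
Qed.

End Kill.

Definition UPreLie := lquot (ideal UPreLie_rel).
HB.instance Definition _ := GRing.Lmodule.on UPreLie.

End UPreLie.

HB.lock Definition Umul (k : fieldType) (L : preLieType k)
  (x y : UPreLie L) : UPreLie L :=
  lproj (ideal (@UPreLie_rel k L))
    (repr (x : Quotient.quot (subspace_zmod (ideal (@UPreLie_rel k L))))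
     * repr (y : Quotient.quot (subspace_zmod (ideal (@UPreLie_rel k L))))).

Section UPreLieAlgebra.
Variables (k : fieldType) (L : preLieType k).

Local Notation F := (falg k (L + L)%type).
Local Notation l a := (fgen k (inl a : (L + L)%type)).
Local Notation r a := (fgen k (inr a : (L + L)%type)).
Local Notation UPreLie := (UPreLie L).
Local Notation UPreLie_rel := (@UPreLie_rel k L).
Local Notation Umul := (@Umul k L).
Local Notation pr := (lproj (ideal UPreLie_rel) : F -> UPreLie).

Definition Uone : UPreLie := pr 1.
Lemma UmulE u v : Umul (pr u : UPreLie) (pr v) = pr (u * v).
Proof.
rewrite Umul.unlock; set u' := repr _; set v' := repr _.
have /lproj_eq/idealP hu : pr u' = pr u by rewrite /lproj reprK.
have /lproj_eq/idealP hv : pr v' = pr v by rewrite /lproj reprK.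
apply/lproj_eq/idealP.
have -> : u' * v' - u * v = u' * (v' - v) + (u' - u) * v.
  by rewrite mulrBr mulrBl addrA subrK.
by apply: in_idealD; [apply: in_idealMl | apply: in_idealMr].
Qed.

Fact UmulA : associative Umul.
Proof.
move=> x y z; have [[u ->] [v ->]] := (lproj_surj x, lproj_surj y).
by have [w ->] := lproj_surj z; rewrite !UmulE mulrA.
Qed.
Fact Umul1l : left_id Uone Umul.
Proof. by move=> x; have [u ->] := lproj_surj x; rewrite UmulE mul1r. Qed.
Fact Umul1r : right_id Uone Umul.
Proof. by move=> x; have [u ->] := lproj_surj x; rewrite UmulE mulr1. Qed.
Fact UmulDl : left_distributive Umul +%R.
Proof.
move=> x y z; have [[u ->] [v ->]] := (lproj_surj x, lproj_surj y).
by have [w ->] := lproj_surj z; rewrite -linearD !UmulE mulrDl linearD.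
Qed.
Fact UmulDr : right_distributive Umul +%R.
Proof.
move=> x y z; have [[u ->] [v ->]] := (lproj_surj x, lproj_surj y).
by have [w ->] := lproj_surj z; rewrite -linearD !UmulE mulrDr linearD.
Qed.

Fact Uone_neq0 : Uone != 0.
Proof.
apply/eqP; rewrite -(linear0 (lproj (ideal UPreLie_rel))) => /lproj_eq.
rewrite subr0 => /(@U_lift_kill k L k^o (fun=> 0) (fun=> 0)) h.
have /eqP : (1 : k^o) = 0.
  rewrite -(rmorph1 (falg_lift (@letter_val k L k^o (fun=> 0) (fun=> 0)))).
  by apply: h => [c a b|c a b|a b|a b];
     rewrite ?scaler0 ?mulr0 ?addr0 ?subr0.
by rewrite oner_eq0.
Qed.

HB.instance Definition _ := GRing.Zmodule_isNzRing.Build UPreLie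
  UmulA Umul1l Umul1r UmulDl UmulDr Uone_neq0.

Lemma UmulrE (u v : F) : pr u * pr v = pr (u * v).
Proof. exact: UmulE. Qed.

Fact UscaleAl (c : k) (x y : UPreLie) : c *: (x * y) = (c *: x) * y.
Proof.
have [[u ->] [v ->]] := (lproj_surj x, lproj_surj y).
by rewrite UmulrE -[c *: pr (u * v)]linearZ -[c *: pr u]linearZ UmulrE scalerAl.
Qed.

HB.instance Definition _ := GRing.Lmodule_isLalgebra.Build k UPreLie UscaleAl.

Fact UscaleAr (c : k) (x y : UPreLie) : c *: (x * y) = x * (c *: y).
Proof.
have [[u ->] [v ->]] := (lproj_surj x, lproj_surj y).
by rewrite UmulrE -[c *: pr (u * v)]linearZ -[c *: pr v]linearZ UmulrE scalerAr.
Qed.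

HB.instance Definition _ := GRing.Lalgebra_isAlgebra.Build k UPreLie UscaleAr.

Definition Ul (a : L) : UPreLie := pr (l a).
Definition Ur (a : L) : UPreLie := pr (r a).

Lemma Ul_linear : linear Ul.
Proof.
move=> c a b; rewrite /Ul -linearP; apply/lproj_eq/idealP/in_ideal_gen.
exact: UPreLie_rel_l.
Qed.

Lemma Ur_linear : linear Ur.
Proof.
move=> c a b; rewrite /Ur -linearP; apply/lproj_eq/idealP/in_ideal_gen.
exact: UPreLie_rel_r.
Qed.

Lemma Urr a b : Ur b * Ur a - Ur (prelie a b) = Ur a * Ur b - Ur (prelie b a).
Proof.
rewrite /Ur !UmulrE -!linearB; apply/lproj_eq/idealP/in_ideal_gen.
exact: UPreLie_rel_rr.
Qed.

Lemma Url a b : Ur b * Ul a - Ul a * Ur b = Ul (prelie a b) - Ul a * Ul b.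
Proof.
rewrite /Ur /Ul !UmulrE -!linearB; apply/lproj_eq/idealP/in_ideal_gen.
exact: UPreLie_rel_rl.
Qed.

Section Lift.
Variables (A : algType k) (hl hr : L -> A).
Hypothesis hl_linear : linear hl.
Hypothesis hr_linear : linear hr.
Hypothesis h_rr : forall a b,
  hr b * hr a - hr (prelie a b) = hr a * hr b - hr (prelie b a).
Hypothesis h_rl : forall a b,
  hr b * hl a - hl a * hr b = hl (prelie a b) - hl a * hl b.

Definition U_lift_fun : UPreLie -> A := 
  lquot_lift (U_lift_kill hl_linear hr_linear h_rr h_rl).

Fact U_lift_is_linear : linear U_lift_fun.
Proof. by move=> c x y; rewrite /U_lift_fun linearP. Qed.

Fact U_lift_is_monoid_morphism : monoid_morphism U_lift_fun.
Proof.
split=> [|x y]; first by rewrite /U_lift_fun lquot_liftE rmorph1.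
have [[u ->] [v ->]] := (lproj_surj x, lproj_surj y).
by rewrite UmulrE /U_lift_fun !lquot_liftE rmorphM.
Qed.

HB.instance Definition _ := GRing.isLinear.Build k UPreLie A *:%R
  U_lift_fun U_lift_is_linear.
HB.instance Definition _ := GRing.isMonoidMorphism.Build UPreLie A
  U_lift_fun U_lift_is_monoid_morphism.

Definition U_lift : {lrmorphism UPreLie -> A} := U_lift_fun.

Lemma U_lift_l a : U_lift (Ul a) = hl a.
Proof. by rewrite /U_lift /= /U_lift_fun lquot_liftE /= falg_liftE. Qed.

Lemma U_lift_r a : U_lift (Ur a) = hr a.
Proof. by rewrite /U_lift /= /U_lift_fun lquot_liftE /= falg_liftE. Qed.

End Lift.
End UPreLieAlgebra.

Section UPreLieMap.
Variables (k : fieldType) (L L' : preLieType k) (f : preLieHom L L').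

Fact Umap_l_linear : linear (fun a => Ul (f a)).
Proof. by move=> c a b; rewrite linearP Ul_linear. Qed.

Fact Umap_r_linear : linear (fun a => Ur (f a)).
Proof. by move=> c a b; rewrite linearP Ur_linear. Qed.

Fact Umap_rr a b : Ur (f b) * Ur (f a) - Ur (f (prelie a b))
  = Ur (f a) * Ur (f b) - Ur (f (prelie b a)).
Proof. by rewrite !plhomM Urr. Qed.

Fact Umap_rl a b : Ur (f b) * Ul (f a) - Ul (f a) * Ur (f b)
  = Ul (f (prelie a b)) - Ul (f a) * Ul (f b).
Proof. by rewrite !plhomM Url. Qed.

Definition UPreLie_map : {lrmorphism UPreLie L -> UPreLie L'} :=
  U_lift Umap_l_linear Umap_r_linear Umap_rr Umap_rl.

Lemma UPreLie_map_l a : UPreLie_map (Ul a) = Ul (f a).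
Proof. exact: U_lift_l. Qed.

Lemma UPreLie_map_r a : UPreLie_map (Ur a) = Ur (f a).
Proof. exact: U_lift_r. Qed.

End UPreLieMap.

(* Main.v *)
(** An [L]-module is a vector space with operators [l_a], [r_a] satisfying the
    relations of [U(L)], so [U(L)] is the free [L]-module on one generator, and
    it suffices to make [T(L) (x) S(L)] into another one. Writing [<|] for the
    pre-Lie product, let [l_a] multiply the left factor by [a], and let [r_b]
    act as [D_b (x) 1 + 1 (x) N_b], where [D_b] is the derivation of [T(L)] with
    [D_b a = a <| b - a b], and [N_b s = b s + s <| b], the product [s <| b]
    being extended to [S(L)] by derivations. Right symmetry makes both
    [b |-> D_b] and [b |-> N_b] satisfy the relation of the [r]'s. Freeness
    splits in two: [S(L)] is freely generated by [1] under the [N_b], as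
    [b s = N_b s - s <| b] reduces the degree, and [T(L)] is freely generated by
    [1] under multiplication by letters. *)

Require Import Defs.
From HB Require Import structures.
From mathcomp Require Import all_boot all_algebra perm.
From mathcomp Require Import boolp functions.
From mathcomp.multinomials Require Import monalg.

Set Implicit Arguments.
Unset Strict Implicit.
Unset Printing Implicit Defensive.

Import GRing.Theory.
Local Open Scope ring_scope.

(** * Linear and bilinear maps *)

Section LinearMaps.
Variable k : fieldType.

Definition spanning (V : lmodType k) (X : Type) (b : X -> V) : Prop :=
  forall (W : lmodType k) (f g : {linear V -> W}),
    (forall x, f (b x) = g (b x)) -> f =1 g.

Lemma spanning_lproj (V : lmodType k) (S : subspace V) (X : Type) (b : X -> V) :
  spanning b -> spanning (fun x => lproj S (b x)).
Proof.
move=> bV W f g fg v; have [u ->] := lproj_surj v.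
exact: (bV _ (f \o lproj S) (g \o lproj S)).
Qed.

Lemma spanning_malg (X : choiceType) :
  spanning (fun x => << x >> : {malg k[X]}).
Proof.
move=> W f g fg u; rewrite (monalgE u) !linear_sum; apply: eq_bigr => x _.
have -> : << u@_x *g x >> = u@_x *: << x >> :> {malg k[X]}.
  by apply/malgP=> y; rewrite mcoeffZ !mcoeffU mulr_natr.
by rewrite !linearZ_LR fg.
Qed.

Definition bilinear_of (U V W : lmodType k) (f : U -> {linear V -> W})
  of forall v, linear (f^~ v) := fun u v => f u v.

Section BilinearOf.
Variables (U V W : lmodType k) (f : U -> {linear V -> W}).
Variable f_linearl : forall v, linear (f^~ v).

Fact bilinear_of_is_bilinear :
  bilinear_for *:%R *:%R (bilinear_of f_linearl).
Proof. by split=> [v|u]; [apply: f_linearl | apply: linearP]. Qed.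

HB.instance Definition _ := bilinear_isBilinear.Build k U V W *:%R *:%R
  (bilinear_of f_linearl) bilinear_of_is_bilinear.

End BilinearOf.

Fact bilinear0_linearl (U V W : lmodType k) (v : V) :
  linear (fun _ : U => (\0 : {linear V -> W}) v).
Proof. by move=> c u u' /=; rewrite scaler0 addr0. Qed.

Definition bilinear0 (U V W : lmodType k) : {bilinear U -> V -> W} :=
  bilinear_of (@bilinear0_linearl U V W).

Lemma spanning_bilinear (U V W : lmodType k) (X : Type) (b : X -> V)
    (f : U -> {linear V -> W}) :
  spanning b -> (forall x, linear (fun u => f u (b x))) ->
  {g : {bilinear U -> V -> W} | forall u, g u =1 f u}.
Proof.
move=> bV f_linear; have f_linearl v : linear (f^~ v).
  move=> c u u'.
  by apply: (bV _ (f (c *: u + u')) (c \*: f u \+ f u')) => x; apply: f_linear.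
by exists (bilinear_of f_linearl).
Qed.

HB.instance Definition _ (V W : lmodType k) :=
  bilinear_isBilinear.Build k V W (tens V W) *:%R *:%R (@tpure k V W)
    (fun w c v v' => tpurePl c v v' w, fun v c w w' => tpurePr c v w w').

HB.instance Definition _ (V W : lmodType k) (v : V) :=
  GRing.isLinear.Build k W (tens V W) *:%R (tpure v)
    (fun c w w' => tpurePr c v w w').

Lemma spanning_tpure (V W : lmodType k) :
  spanning (fun p : V * W => tpure p.1 p.2).
Proof.
move=> E f g fg; apply: (spanning_lproj (@spanning_malg _)) => -[v w].
exact: (fg (v, w)).
Qed.

End LinearMaps.

(** * Tensor and symmetric powers in terms of words *)

Section DirectSum.
Variables (k : fieldType) (V : nat -> lmodType k).

Definition dsum_in_val n (v : V n) m : V m :=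
  if n =P m is ReflectT e then ecast j (V j) e v else 0.

Lemma dsum_in_val_id n (v : V n) : dsum_in_val v n = v.
Proof.
rewrite /dsum_in_val; case: eqP => // e.
by rewrite (eq_irrelevance e (erefl n)).
Qed.

Lemma dsum_in_val_neq n (v : V n) m : n != m -> dsum_in_val v m = 0.
Proof. by rewrite /dsum_in_val; case: eqP. Qed.

Fact dsum_in_fin n (v : V n) :
  exists N, forall m, (N <= m)%N -> dsum_in_val v m = 0.
Proof. by exists n.+1 => m nm; rewrite dsum_in_val_neq // ltn_eqF. Qed.

Definition dsum_in n (v : V n) : dsum V := DSum (dsum_in_fin v).

Fact dsum_in_is_linear n : linear (@dsum_in n).
Proof.
move=> c u v; apply: dsumP => m /=.
have [<-|nm] := eqVneq n m; first by rewrite !dsum_in_val_id.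
by rewrite !dsum_in_val_neq // scaler0 addr0.
Qed.

HB.instance Definition _ n := GRing.isLinear.Build k (V n) (dsum V) *:%R
  (@dsum_in n) (@dsum_in_is_linear n).

Lemma dsum_val_sum (I : Type) (r : seq I) (F : I -> dsum V) m :
  (\sum_(i <- r) F i : dsum V) m = \sum_(i <- r) F i m.
Proof. by elim: r => [|i r IH]; rewrite ?big_nil // !big_cons -IH. Qed.

Lemma dsum_decomp (x : dsum V) N : (forall n, (N <= n)%N -> x n = 0) ->
  x = \sum_(n < N) dsum_in (x n).
Proof.
move=> xN; apply: dsumP => m; rewrite dsum_val_sum /=.
have [Nm|mN] := leqP N m.
  rewrite xN // big1 // => i _; apply: dsum_in_val_neq.
  by rewrite ltn_eqF // (leq_trans (ltn_ord i)).
rewrite (bigD1 (Ordinal mN)) //= dsum_in_val_id big1 ?addr0 // => i ne.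
exact: dsum_in_val_neq.
Qed.

Lemma spanning_dsum (X : nat -> Type) (b : forall n, X n -> V n) :
  (forall n, spanning (@b n)) ->
  spanning (fun p : {n & X n} => dsum_in (b (tag p) (tagged p))).
Proof.
move=> bV W f g fg x; have [N /dsum_decomp ->] := dsum_fin x.
rewrite !linear_sum; apply: eq_bigr => n _.
apply: (bV n _ (f \o @dsum_in n) (g \o @dsum_in n)) => y.
exact: (fg (Tagged X y)).
Qed.

Section Lift.
Variables (W : lmodType k) (f : forall n, {linear V n -> W}).

Definition dsum_lift (x : dsum V) : W :=
  \sum_(n < sval (cid (dsum_fin x))) f n (x n).

Lemma dsum_liftEw (x : dsum V) N : (forall n, (N <= n)%N -> x n = 0) ->
  dsum_lift x = \sum_(n < N) f n (x n).
Proof.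
rewrite /dsum_lift; case: cid => M /= xM xN.
have sum_widen P Q : (P <= Q)%N -> (forall n, (P <= n)%N -> x n = 0) ->
    \sum_(n < P) f n (x n) = \sum_(n < Q) f n (x n).
  move=> PQ xP; rewrite (big_ord_widen Q (fun n => f n (x n))) //.
  rewrite big_mkcond; apply: eq_bigr => i _; case: ltnP => // /xP ->.
  by rewrite linear0.
rewrite (sum_widen M (maxn M N)) ?leq_maxl //.
by rewrite -(sum_widen N (maxn M N)) ?leq_maxr.
Qed.

Fact dsum_lift_is_linear : linear dsum_lift.
Proof.
move=> c x y; have [[M xM] [N yN]] := (dsum_fin x, dsum_fin y).
have xP n : (maxn M N <= n)%N -> x n = 0 by rewrite geq_max => /andP[/xM].
have yP n : (maxn M N <= n)%N -> y n = 0 by rewrite geq_max => /andP[_ /yN].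
rewrite !(@dsum_liftEw _ (maxn M N)) //; last first.
  by move=> n le; rewrite [LHS]/= xP // yP // scaler0 addr0.
rewrite scaler_sumr -big_split; apply: eq_bigr => n _.
by rewrite [X in f n X]/= linearP.
Qed.

HB.instance Definition _ := GRing.isLinear.Build k (dsum V) W *:%R
  dsum_lift dsum_lift_is_linear.

Lemma dsum_liftE n (v : V n) : dsum_lift (dsum_in v) = f n v.
Proof.
rewrite (@dsum_liftEw _ n.+1) => [|m nm]; last first.
  by rewrite /= dsum_in_val_neq // ltn_eqF.
rewrite big_ord_recr /= dsum_in_val_id big1 ?add0r // => i _.
by rewrite dsum_in_val_neq ?linear0 // gtn_eqF.
Qed.

End Lift.
End DirectSum.

Lemma dsum_map_in (k : fieldType) (V W : nat -> lmodType k)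
    (f : forall n, {linear V n -> W n}) n (v : V n) :
  dsum_map f (dsum_in v) = dsum_in (f n v).
Proof.
apply: dsumP => m /=.
have [<-|nm] := eqVneq n m; first by rewrite !dsum_in_val_id.
by rewrite !dsum_in_val_neq // linear0.
Qed.

Section Words.
Variables (k : fieldType) (V : lmodType k).

Definition word_of n (w : {ffun 'I_n -> V}) : n.-tuple V := [tuple w i | i < n].

Definition ffun_of n (s : seq V) : {ffun 'I_n -> V} :=
  [ffun i : 'I_n => nth 0 s i].

Lemma nth_word_of n (w : {ffun 'I_n -> V}) (i : 'I_n) :
  nth 0 (word_of w) i = w i.
Proof. by rewrite -tnth_nth tnth_mktuple. Qed.

Lemma word_ofK n : cancel (fun w => word_of w : seq V) (@ffun_of n).
Proof. by move=> w; apply/ffunP=> i; rewrite ffunE nth_word_of. Qed.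

Lemma ffun_ofK s : word_of (ffun_of (size s) s) = s :> seq V.
Proof.
apply: (@eq_from_nth _ 0) => [|i]; rewrite size_tuple // => lt.
by rewrite (nth_word_of _ (Ordinal lt)) ffunE.
Qed.

Lemma word_of_subst n (w : {ffun 'I_n -> V}) i a :
  word_of (subst_at w i a)
  = take i (word_of w) ++ a :: drop i.+1 (word_of w) :> seq V.
Proof.
have -> : take i (word_of w) ++ a :: drop i.+1 (word_of w)
    = set_nth 0 (word_of w) i a by rewrite set_nthE size_tuple ltn_ord.
apply: (@eq_from_nth _ 0) => [|j].
  by rewrite size_set_nth !size_tuple (maxn_idPr _).
rewrite size_tuple => lt; rewrite nth_set_nth (nth_word_of _ (Ordinal lt)).
by rewrite ffunE /= (nth_word_of _ (Ordinal lt)).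
Qed.

Lemma ffun_of_subst n s1 s2 (lt : (size s1 < n)%N) a :
  ffun_of n (s1 ++ a :: s2)
  = subst_at (ffun_of n (s1 ++ 0 :: s2)) (Ordinal lt) a.
Proof.
apply/ffunP=> j; rewrite !ffunE !nth_cat -val_eqE /=.
have [//|gt|->] := ltngtP (nat_of_ord j) (size s1); last by rewrite subnn.
by rewrite -(subnSK gt).
Qed.

Lemma perm_word_of n (w : {ffun 'I_n -> V}) (s : 'S_n) :
  perm_eq (word_of [ffun j => w (s j)]) (word_of w).
Proof.
apply/tuple_permP; exists s; congr val.
by apply: eq_mktuple => i; rewrite ffunE tnth_mktuple.
Qed.

Lemma perm_ffun_of n s t : size t = n -> perm_eq s t ->
  exists p : 'S_n, ffun_of n s = [ffun j => ffun_of n t (p j)].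
Proof.
move=> tn; rewrite -[t]/(val (Tuple (introT eqP tn))).
move=> /tuple_permP[p ->]; exists p; apply/ffunP=> j.
by rewrite !ffunE nth_mktuple (tnth_nth 0).
Qed.

Definition multilinear (W : lmodType k) (h : seq V -> W) : Prop :=
  forall s1 s2, linear (fun a => h (s1 ++ a :: s2)).

Definition perm_invariant (X : Type) (h : seq V -> X) : Prop :=
  forall s t, perm_eq s t -> h s = h t.

Lemma swap_perm_invariant (X : Type) (h : seq V -> X) :
  (forall s1 a b s2, h (s1 ++ [:: a, b & s2]) = h (s1 ++ [:: b, a & s2])) ->
  perm_invariant h.
Proof.
move=> h_swap s t; elim: s h h_swap t => [|a s IH] h h_swap t st.
  by move: st; rewrite perm_sym => /perm_nilP ->.
have /splitPr at_ : a \in t by rewrite -(perm_mem st) mem_head.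
case: at_ st => t1 t2 st.
have {}st : perm_eq s (t1 ++ t2).
  by move: st; rewrite perm_sym perm_catC /= perm_cons perm_catC perm_sym.
have -> : h (t1 ++ a :: t2) = h (a :: t1 ++ t2).
  elim/last_ind: t1 {st} t2 => [//|t1 b IHt] t2.
  by rewrite !cat_rcons h_swap IHt.
by apply: (IH (fun w => h (a :: w))) => // s1 b c s2; apply: (h_swap (a :: s1)).
Qed.

Lemma multilinear_word_of (W : lmodType k) (h : seq V -> W) n
    (w : {ffun 'I_n -> V}) i :
  multilinear h -> linear (fun a => h (word_of (subst_at w i a))).
Proof. by move=> h_lin c a b; rewrite !word_of_subst h_lin. Qed.

Lemma multilinear_comp (W E : lmodType k) (f : {linear W -> E}) h :
  multilinear h -> multilinear (f \o h).
Proof. by move=> h_lin s1 s2 c a b /=; rewrite h_lin linearP. Qed.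

Lemma multilinear_cons (W : lmodType k) (h : seq V -> W) a :
  multilinear h -> multilinear (fun s => h (a :: s)).
Proof. by move=> h_lin s1 s2; apply: (h_lin (a :: s1)). Qed.

End Words.

Section TensorAlgebra.
Variables (k : fieldType) (V : lmodType k).

Definition tword (s : seq V) : Tmod V :=
  dsum_in (V := fun n => tpow n V) (pow_pure (ffun_of (size s) s)).

Lemma twordE n s : size s = n ->
  tword s = dsum_in (V := fun n => tpow n V) (pow_pure (ffun_of n s)).
Proof. by move=> <-. Qed.

Lemma tword_multilinear : multilinear tword.
Proof.
move=> s1 s2 c a b; set n := (size s1 + (size s2).+1)%N.
have lt : (size s1 < n)%N by rewrite /n addnS ltnS leq_addr.
have twordn x := @twordE n (s1 ++ x :: s2) (size_cat s1 (x :: s2)).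
rewrite 3!twordn (ffun_of_subst _ lt (_ + _)) pow_pureP -2!ffun_of_subst.
by rewrite linearP.
Qed.

Lemma spanning_tword : spanning tword.
Proof.
have pow_pure_span n : spanning (@pow_pure k n V).
  exact: spanning_lproj (@spanning_malg k _).
move=> W f g fg; apply: (spanning_dsum pow_pure_span) => -[n w].
by have := fg (word_of w); rewrite (@twordE n) ?size_tuple // word_ofK.
Qed.

Lemma Tmod_lift (W : lmodType k) (h : seq V -> W) : multilinear h ->
  {f : {linear Tmod V -> W} | forall s, f (tword s) = h s}.
Proof.
move=> h_lin; exists (dsum_lift (fun n => tpow_lift
  (h := fun w : {ffun 'I_n -> V} => h (word_of w))
  (fun w i => multilinear_word_of w i h_lin))) => s.
by rewrite /= dsum_liftE tpow_liftE ffun_ofK.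
Qed.

Definition symmetrize : {linear Tmod V -> Smod V} :=
  dsum_map (fun n =>
    lproj (lspan (@spow_rel k n V)) : {linear tpow n V -> spow n V}).

Definition sword (s : seq V) : Smod V := symmetrize (tword s).

Lemma swordE n s : size s = n ->
  sword s = dsum_in (V := fun n => spow n V) (spow_pure (ffun_of n s)).
Proof. by move=> <-; rewrite /sword /symmetrize dsum_map_in. Qed.

Lemma sword_multilinear : multilinear sword.
Proof. exact/multilinear_comp/tword_multilinear. Qed.

Lemma sword_perm_invariant : perm_invariant sword.
Proof.
move=> s t st; have [p sE] := perm_ffun_of erefl st.
rewrite (swordE (perm_size st)) (swordE erefl) sE; congr (dsum_in _).
exact/lproj_eq/lspan_gen/spow_relP.
Qed.

Lemma spanning_sword : spanning sword.
Proof.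
have spow_pure_span n : spanning (@spow_pure k n V).
  exact/spanning_lproj/spanning_lproj/spanning_malg.
move=> W f g fg; apply: (spanning_dsum spow_pure_span) => -[n w].
by have := fg (word_of w); rewrite (@swordE n) ?size_tuple // word_ofK.
Qed.

Lemma Smod_lift (W : lmodType k) (h : seq V -> W) :
  multilinear h -> perm_invariant h ->
  {f : {linear Smod V -> W} | forall s, f (sword s) = h s}.
Proof.
move=> h_lin h_sym; exists (dsum_lift (fun n => spow_lift
  (h := fun w : {ffun 'I_n -> V} => h (word_of w))
  (fun w i => multilinear_word_of w i h_lin)
  (fun w s => h_sym _ _ (perm_word_of w s)))) => s.
by rewrite (swordE erefl) /= dsum_liftE spow_liftE ffun_ofK.
Qed.

Lemma Smod_lift_graded (W : lmodType k) (f : nat -> {linear Smod V -> W}) :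
  {g : {linear Smod V -> W} | forall s, g (sword s) = f (size s) (sword s)}.
Proof.
exists (dsum_lift (fun n => f n \o @dsum_in k (fun n => spow n V) n)) => s.
by rewrite (swordE erefl) /= dsum_liftE.
Qed.

End TensorAlgebra.

Section WordMaps.
Variables (k : fieldType) (V V' : lmodType k) (f : {linear V -> V'}).

Lemma map_word_ffun_of s :
  map_word f (ffun_of (size s) s) = ffun_of (size s) (map f s).
Proof. by apply/ffunP=> i; rewrite !ffunE (nth_map 0). Qed.

Lemma Tmod_map_tword s : Tmod_map f (tword s) = tword (map f s).
Proof.
rewrite /Tmod_map dsum_map_in tpow_mapE map_word_ffun_of.
by rewrite (twordE (size_map f s)).
Qed.

Lemma Smod_map_sword s : Smod_map f (sword s) = sword (map f s).
Proof.
rewrite (swordE erefl) /Smod_map dsum_map_in spow_mapE map_word_ffun_of.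
by rewrite (swordE (size_map f s)).
Qed.

End WordMaps.

(** * Recursion on the first letter *)

Section WordRecursion.
Variables (k : fieldType) (V W E : lmodType k) (q : seq V -> W) (x0 : E).
Variables (F : {bilinear V -> W -> E}) (G : {bilinear V -> E -> E}).

Fixpoint word_rec (s : seq V) : E :=
  if s is a :: t then F a (q t) + G a (word_rec t) else x0.

Lemma word_rec_multilinear : multilinear q -> multilinear word_rec.
Proof.
move=> q_lin; elim=> [|a s1 IH] s2 c x y /=.
  by rewrite !linearPl scalerDr addrACA.
by rewrite q_lin IH !linearPr scalerDr addrACA.
Qed.

Lemma word_rec_perm_invariant : perm_invariant q ->
  (forall a b s e, F a (q (b :: s)) + G a (F b (q s) + G b e)
                 = F b (q (a :: s)) + G b (F a (q s) + G a e)) ->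
  perm_invariant word_rec.
Proof.
move=> q_perm FG; apply: swap_perm_invariant; elim=> [|a s1 IH] b c s2 /=.
  exact: FG.
rewrite IH; congr (F a _ + _); apply: q_perm.
by rewrite perm_cat2l (perm_catCA [:: b] [:: c]).
Qed.

End WordRecursion.

Section TensorRecursion.
Variables (k : fieldType) (V : lmodType k).

Definition tnil : Tmod V := tword [::].

(* The operators [tcons], [scons], [tder], etc. are extracted from opaque     *)
(* lemmas, which keeps simplification and unification from unfolding them.   *)
Lemma exists_tcons :
  {f : {bilinear V -> Tmod V -> Tmod V} |
    forall a s, f a (tword s) = tword (a :: s)}.
Proof.
pose f a := sval (Tmod_lift (multilinear_cons a (@tword_multilinear k V))).
have fE a s : f a (tword s) = tword (a :: s) by rewrite /f; case: Tmod_lift.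
have f_linear s : linear (fun a => f a (tword s)).
  by move=> c a b; rewrite !fE (@tword_multilinear _ _ [::]).
have [g gE] := spanning_bilinear (@spanning_tword k V) f_linear.
by exists g => a s; rewrite gE fE.
Qed.

Definition tcons : {bilinear V -> Tmod V -> Tmod V} := sval exists_tcons.

Lemma tconsE a s : tcons a (tword s) = tword (a :: s).
Proof. exact: (svalP exists_tcons). Qed.

Lemma Tmod_ext (E : lmodType k) (f g : {linear Tmod V -> E}) :
  f tnil = g tnil -> (forall a t, f t = g t -> f (tcons a t) = g (tcons a t)) ->
  f =1 g.
Proof.
move=> fg_nil fg_cons; apply: spanning_tword; elim=> [//|a s IH].
by rewrite -tconsE fg_cons.
Qed.

Lemma Tmod_bilinear (U E : lmodType k) (f : U -> {linear Tmod V -> E}) :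
  linear (fun u => f u tnil) ->
  (forall a t, linear (f^~ t) -> linear (fun u => f u (tcons a t))) ->
  {g : {bilinear U -> Tmod V -> E} | forall u, g u =1 f u}.
Proof.
move=> f_nil f_cons; apply: (spanning_bilinear (@spanning_tword k V)).
by elim=> [//|a s IH]; rewrite -tconsE; apply: f_cons.
Qed.

Lemma Tmod_rec (E : lmodType k) (x0 : E) (F : {bilinear V -> Tmod V -> E})
    (G : {bilinear V -> E -> E}) :
  {f : {linear Tmod V -> E} |
    f tnil = x0 & forall a t, f (tcons a t) = F a t + G a (f t)}.
Proof.
have [f fE] := Tmod_lift (word_rec_multilinear x0 F G (@tword_multilinear k V)).
exists f => [|a]; first exact: fE.
apply: (spanning_tword (f := f \o tcons a) (g := F a \+ (G a \o f))) => s /=.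
by rewrite tconsE !fE.
Qed.

End TensorRecursion.

Arguments tnil {k V}.
Arguments tcons {k V}.

Section SymmetricRecursion.
Variables (k : fieldType) (V : lmodType k).

Definition snil : Smod V := sword [::].

Lemma exists_scons :
  {f : {bilinear V -> Smod V -> Smod V} |
    forall a s, f a (sword s) = sword (a :: s)}.
Proof.
have cons_perm a : perm_invariant (fun s => sword (a :: s) : Smod V).
  by move=> s t st; apply: sword_perm_invariant; rewrite perm_cons.
pose f a := sval (Smod_lift
  (multilinear_cons a (@sword_multilinear k V)) (cons_perm a)).
have fE a s : f a (sword s) = sword (a :: s) by rewrite /f; case: Smod_lift.
have f_linear s : linear (fun a => f a (sword s)).
  by move=> c a b; rewrite !fE (@sword_multilinear _ _ [::]).
have [g gE] := spanning_bilinear (@spanning_sword k V) f_linear.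
by exists g => a s; rewrite gE fE.
Qed.

Definition scons : {bilinear V -> Smod V -> Smod V} := sval exists_scons.

Lemma sconsE a s : scons a (sword s) = sword (a :: s).
Proof. exact: (svalP exists_scons). Qed.

Lemma sconsC a b s : scons a (scons b s) = scons b (scons a s).
Proof.
apply: (spanning_sword (f := scons a \o scons b)
  (g := scons b \o scons a)) => w /=.
rewrite !sconsE; apply: sword_perm_invariant.
by rewrite (perm_catCA [:: a] [:: b]).
Qed.

Lemma Smod_ext (E : lmodType k) (f g : {linear Smod V -> E}) :
  f snil = g snil -> (forall a s, f s = g s -> f (scons a s) = g (scons a s)) ->
  f =1 g.
Proof.
move=> fg_nil fg_cons; apply: spanning_sword; elim=> [//|a s IH].
by rewrite -sconsE fg_cons.
Qed.

Lemma Smod_bilinear (U E : lmodType k) (f : U -> {linear Smod V -> E}) :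
  linear (fun u => f u snil) ->
  (forall a s, linear (f^~ s) -> linear (fun u => f u (scons a s))) ->
  {g : {bilinear U -> Smod V -> E} | forall u, g u =1 f u}.
Proof.
move=> f_nil f_cons; apply: (spanning_bilinear (@spanning_sword k V)).
by elim=> [//|a s IH]; rewrite -sconsE; apply: f_cons.
Qed.

Lemma Smod_rec (E : lmodType k) (x0 : E) (F : {bilinear V -> Smod V -> E})
    (G : {bilinear V -> E -> E}) :
  (forall a b s e, F a (scons b s) + G a (F b s + G b e)
                 = F b (scons a s) + G b (F a s + G a e)) ->
  {f : {linear Smod V -> E} |
    f snil = x0 & forall a s, f (scons a s) = F a s + G a (f s)}.
Proof.
move=> FG.
have FG_word a b s e : F a (sword (b :: s)) + G a (F b (sword s) + G b e)
    = F b (sword (a :: s)) + G b (F a (sword s) + G a e) by rewrite -!sconsE.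
have [f fE] := Smod_lift (word_rec_multilinear x0 F G (@sword_multilinear k V))
  (word_rec_perm_invariant x0 (@sword_perm_invariant k V) FG_word).
exists f => [|a]; first exact: fE.
apply: (spanning_sword (f := f \o scons a) (g := F a \+ (G a \o f))) => s /=.
by rewrite sconsE !fE.
Qed.

End SymmetricRecursion.

Arguments snil {k V}.
Arguments scons {k V}.

Section ConsMaps.
Variables (k : fieldType) (V V' : lmodType k) (f : {linear V -> V'}).

Lemma Tmod_map_tnil : Tmod_map f tnil = tnil.
Proof. exact: Tmod_map_tword. Qed.

Lemma Tmod_map_tcons a t :
  Tmod_map f (tcons a t) = tcons (f a) (Tmod_map f t).
Proof.
apply: (spanning_tword (f := Tmod_map f \o tcons a)
  (g := tcons (f a) \o Tmod_map f)) => s /=.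
by rewrite !(tconsE, Tmod_map_tword).
Qed.

Lemma Smod_map_snil : Smod_map f snil = snil.
Proof. exact: Smod_map_sword. Qed.

Lemma Smod_map_scons a s :
  Smod_map f (scons a s) = scons (f a) (Smod_map f s).
Proof.
apply: (spanning_sword (f := Smod_map f \o scons a)
  (g := scons (f a) \o Smod_map f)) => w /=.
by rewrite !(sconsE, Smod_map_sword).
Qed.

End ConsMaps.

(** * Right-symmetric actions *)

Lemma subr_eq_sub (Z : zmodType) (a b c d : Z) :
  (a - b = c - d) <-> (a + d = c + b).
Proof.
split=> [/(congr1 (fun z => z + b + d))|/(congr1 (fun z => z - b - d))].
  by rewrite subrK (addrAC (c - d)) subrK.
by rewrite addrK (addrAC a) addrK.
Qed.

Section RightSymmetricActions.
Variables (k : fieldType) (L : preLieType k).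

(* The relation [r_b r_a - r_{a <| b} = r_a r_b - r_{b <| a}], rearranged so  *)
(* that no subtraction occurs.                                               *)
Definition right_symmetric (E : lmodType k) (r : L -> E -> E) : Prop :=
  forall a b x, r b (r a x) + r (prelie b a) x = r a (r b x) + r (prelie a b) x.

(* With [e = 1] for the action on [T(L)] and [e = 0] for those on [S(L)].     *)
Definition twisted_leibniz (E : lmodType k) (e : k) (m D : L -> E -> E)
    : Prop :=
  forall b a x, D b (m a x) = m (prelie a b) x - e *: m a (m b x) + m a (D b x).

Lemma prelie_right_symmetric (x a b : L) :
  prelie (prelie x a) b + prelie x (prelie b a)
  = prelie (prelie x b) a + prelie x (prelie a b).
Proof. exact/subr_eq_sub/prelie_right_sym. Qed.

Lemma twisted_leibniz_right_symmetric (E : lmodType k) (e : k)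
    (m D : {bilinear L -> E -> E}) a b x y : twisted_leibniz e m D ->
  D b (D a x) + D (prelie b a) x = D a (D b x) + D (prelie a b) x ->
  D b (D a (m y x)) + D (prelie b a) (m y x)
  = D a (D b (m y x)) + D (prelie a b) (m y x).
Proof.
move=> D_m D_ab.
pose mixed c d := m (prelie y c) (D d x) - e *: m (prelie y c) (m d x)
  - e *: m y (m (prelie c d) x) - e *: m y (m c (D d x))
  + e *: (e *: m y (m c (m d x))).
have expand c d : D d (D c (m y x)) + D (prelie d c) (m y x)
  = m (prelie (prelie y c) d + prelie y (prelie d c)) x
    + m y (D d (D c x) + D (prelie d c) x) + (mixed c d + mixed d c).
  rewrite /mixed !(D_m, linearDr, linearNr, linearZr_LR) linearDl.
  rewrite !(scalerDr, scalerN, opprD, opprK).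
  exact: (AC (3*(2*3)*3*3)
    (1*12*(11*14)*(3*2*6*8*7*(9*4*13*10*5)))).
by rewrite !expand prelie_right_symmetric D_ab (addrC (mixed a b)).
Qed.

End RightSymmetricActions.

Section TensorDerivation.
Variables (k : fieldType) (L : preLieType k).

Lemma exists_tder : {D : {bilinear L -> Tmod L -> Tmod L} |
  (forall b, D b tnil = 0) /\ twisted_leibniz 1 tcons D}.
Proof.
have tcons_head_linearl b (t : Tmod L) :
    linear (fun a => (tcons (prelie a b) \- (tcons a \o tcons b)) t).
  move=> c x y /=; rewrite prelie_linearl !linearPl.
  by rewrite scalerBr opprD addrACA.
have D b : {f : {linear Tmod L -> Tmod L} | f tnil = 0 & forall a t,
    f (tcons a t) = tcons (prelie a b) t - tcons a (tcons b t) + tcons a (f t)}.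
  exact: (Tmod_rec 0 (bilinear_of (tcons_head_linearl b)) tcons).
have [c x y|a t IH c x y|G GE] := Tmod_bilinear (f := fun b => s2val (D b)).
- by rewrite !(s2valP (D _)) scaler0 addr0.
- rewrite !(s2valP' (D _)) IH prelie_linearr !linearPl !linearPr.
  rewrite scalerDr scalerBr [RHS]addrACA.
  by congr (_ + _); rewrite opprD addrACA.
exists G; split=> [b|b a t]; first by rewrite GE (s2valP (D b)).
by rewrite !GE (s2valP' (D b)) scale1r.
Qed.

Definition tder : {bilinear L -> Tmod L -> Tmod L} := sval exists_tder.

Lemma tder_nil b : tder b tnil = 0.
Proof. exact: (svalP exists_tder).1. Qed.

Lemma tder_leibniz : twisted_leibniz 1 tcons tder.
Proof. exact: (svalP exists_tder).2. Qed.

Lemma tder_cons b a t :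
  tder b (tcons a t)
  = tcons (prelie a b) t - tcons a (tcons b t) + tcons a (tder b t).
Proof. by rewrite tder_leibniz scale1r. Qed.

Lemma tder_right_symmetric : right_symmetric tder.
Proof.
move=> a b; apply: (Tmod_ext (f := (tder b \o tder a) \+ tder (prelie b a))
  (g := (tder a \o tder b) \+ tder (prelie a b))) => /= [|x t].
  by rewrite !(tder_nil, linear0).
exact: (twisted_leibniz_right_symmetric _ tder_leibniz).
Qed.

End TensorDerivation.

Arguments tder {k L}.

Section SymmetricDerivation.
Variables (k : fieldType) (L : preLieType k).

Lemma exists_sder : {D : {bilinear L -> Smod L -> Smod L} |
  (forall b, D b snil = 0) /\
  forall b a s, D b (scons a s) = scons (prelie a b) s + scons a (D b s)}.
Proof.
have scons_prelie_linearl b (s : Smod L) :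
    linear (fun a => scons (prelie a b) s).
  by move=> c x y; rewrite prelie_linearl linearPl.
have leibniz_comm b x y (s e : Smod L) :
    scons (prelie x b) (scons y s) + scons x (scons (prelie y b) s + scons y e)
    = scons (prelie y b) (scons x s)
      + scons y (scons (prelie x b) s + scons x e).
  rewrite !linearDr (sconsC y x) (sconsC y (prelie x b)).
  by rewrite (sconsC x (prelie y b)) addrCA.
have D b : {f : {linear Smod L -> Smod L} | f snil = 0 & forall a s,
    f (scons a s) = scons (prelie a b) s + scons a (f s)}.
  pose F := bilinear_of (scons_prelie_linearl b).
  exact: (Smod_rec (F := F) 0 (leibniz_comm b)).
have [c x y|a s IH c x y|G GE] := Smod_bilinear (f := fun b => s2val (D b)).
- by rewrite !(s2valP (D _)) scaler0 addr0.
- rewrite !(s2valP' (D _)) IH prelie_linearr linearPl !linearPr.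
  by rewrite scalerDr addrACA.
exists G; split=> [b|b a s]; first by rewrite GE (s2valP (D b)).
by rewrite !GE (s2valP' (D b)).
Qed.

Definition sder : {bilinear L -> Smod L -> Smod L} := sval exists_sder.

Lemma sder_nil b : sder b snil = 0.
Proof. exact: (svalP exists_sder).1. Qed.

Lemma sder_cons b a s :
  sder b (scons a s) = scons (prelie a b) s + scons a (sder b s).
Proof. exact: (svalP exists_sder).2. Qed.

Lemma sder_leibniz : twisted_leibniz 0 scons sder.
Proof. by move=> b a s; rewrite sder_cons scale0r subr0. Qed.

Lemma sder_right_symmetric : right_symmetric sder.
Proof.
move=> a b; apply: (Smod_ext (f := (sder b \o sder a) \+ sder (prelie b a))
  (g := (sder a \o sder b) \+ sder (prelie a b))) => /= [|x s].
  by rewrite !(sder_nil, linear0).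
exact: (twisted_leibniz_right_symmetric _ sder_leibniz).
Qed.

Lemma sder_eq_on_length (E : lmodType k) (f g : {linear Smod L -> E}) b w :
  (forall v, size v = size w -> f (sword v) = g (sword v)) ->
  f (sder b (sword w)) = g (sder b (sword w)).
Proof.
elim: w f g => [|a w IH] f g fg; first by rewrite sder_nil !linear0.
rewrite -sconsE sder_cons !linearD sconsE fg //; congr (_ + _).
apply: (IH (f \o scons a) (g \o scons a)) => v vw /=.
by rewrite sconsE fg //= vw.
Qed.

End SymmetricDerivation.

Arguments sder {k L}.

Section SymmetricAction.
Variables (k : fieldType) (L : preLieType k).

Lemma exists_sact : {r : {bilinear L -> Smod L -> Smod L} |
  forall b s, r b s = scons b s + sder b s}.
Proof.
have r_linearl (s : Smod L) : linear (fun b => (scons b \+ sder b) s).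
  by move=> c x y /=; rewrite !linearPl scalerDr addrACA.
by exists (bilinear_of r_linearl).
Qed.

Definition sact : {bilinear L -> Smod L -> Smod L} := sval exists_sact.

Lemma sactE b s : sact b s = scons b s + sder b s.
Proof. exact: (svalP exists_sact). Qed.

Lemma sact_nil b : sact b snil = scons b snil.
Proof. by rewrite sactE sder_nil addr0. Qed.

Lemma sact_cons b a s :
  sact b (scons a s) = scons (prelie a b) s + scons a (sact b s).
Proof. by rewrite !sactE sder_cons linearDr sconsC addrCA. Qed.

Lemma sact_leibniz : twisted_leibniz 0 scons sact.
Proof. by move=> b a s; rewrite sact_cons scale0r subr0. Qed.

Lemma sact_right_symmetric : right_symmetric sact.
Proof.
move=> a b; apply: (Smod_ext (f := (sact b \o sact a) \+ sact (prelie b a))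
  (g := (sact a \o sact b) \+ sact (prelie a b))) => /= [|x s].
  rewrite !(sact_nil, sact_cons) (sconsC a b).
  by rewrite addrAC -!addrA (addrC (scons (prelie a b) _)) -addrA.
exact: (twisted_leibniz_right_symmetric _ sact_leibniz).
Qed.

Lemma sact_ext (E : lmodType k) (f g : {linear Smod L -> E}) :
  f snil = g snil -> (forall b s, f s = g s -> f (sact b s) = g (sact b s)) ->
  f =1 g.
Proof.
move=> fg_nil fg_act; apply: spanning_sword => w.
move: {2}(size w) (erefl (size w)) => n; elim: n w => [|n IH] [|b w] //= [wn].
have sconsB s : scons b s = sact b s - sder b s by rewrite sactE addrK.
rewrite -sconsE sconsB !linearB fg_act ?IH //; congr (_ - _).
by apply: sder_eq_on_length => v vw; rewrite IH // vw.
Qed.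

End SymmetricAction.

Arguments sact {k L}.

Section FreeLieModule.
Variables (k : fieldType) (L : preLieType k) (E : lmodType k) (x0 : E).
Variables (r : {bilinear L -> E -> E}) (r_sym : right_symmetric r).

(* The map [f] to be built is forced to satisfy                              *)
(* [f (b s) = r_b (f s) - f (s <| b)]. As [s <| b] has the degree of [s], the *)
(* successive approximations [f (b s) = r_b (g s) - g (s <| b)] are exact in  *)
(* larger and larger degrees.                                                *)
Definition lift_compatible (g : {linear Smod L -> E}) : Prop := forall a b s,
  r a (g (scons b s)) - g (sder a (scons b s))
  = r b (g (scons a s)) - g (sder b (scons a s)).

Lemma exists_lift_step (g : {linear Smod L -> E}) : lift_compatible g ->
  {f : {linear Smod L -> E} |
    f snil = x0 & forall b s, f (scons b s) = r b (g s) - g (sder b s)}.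
Proof.
move=> g_compat.
have F_linearl s : linear (fun b => ((r b \o g) \- (g \o sder b)) s).
  by move=> c x y /=; rewrite !linearPl linearP scalerBr opprD addrACA.
have [|f f_nil f_cons] :=
  Smod_rec x0 (F := bilinear_of F_linearl) (G := bilinear0 _ _ _).
  by move=> a b s e; rewrite [LHS]addr0 [RHS]addr0; apply: g_compat.
by exists f => // b s; rewrite f_cons [LHS]addr0.
Qed.

Lemma lift_step_compatible (g f : {linear Smod L -> E}) :
  (forall b s, f (scons b s) = r b (g s) - g (sder b s)) -> lift_compatible f.
Proof.
move=> f_cons a b s.
have expand c d : r c (f (scons d s)) - f (sder c (scons d s))
    = (r c (r d (g s)) - r (prelie d c) (g s))
      + g (sder d (sder c s) + sder (prelie d c) s)
      - (r c (g (sder d s)) + r d (g (sder c s))).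
  rewrite sder_cons (linearD f) !f_cons linearBr (linearD g) !(opprD, opprK).
  exact: (AC (2*(2*2)) (1*3*(6*4)*(2*5))).
rewrite !expand sder_right_symmetric (addrC (r a (g _))); congr (_ + _ - _).
exact/subr_eq_sub/r_sym.
Qed.

Lemma exists_lift_approximations : {g : nat -> {linear Smod L -> E} |
  forall n, g n.+1 snil = x0 /\
    forall b s, g n.+1 (scons b s) = r b (g n s) - g n (sder b s)}.
Proof.
have zero_compat : lift_compatible \0 by move=> a b s; rewrite !linear0.
pose lift_step (g : {g | lift_compatible g}) : {g | lift_compatible g} :=
  let: exist2 f _ f_cons := exists_lift_step (svalP g) in
  exist _ f (lift_step_compatible f_cons).
exists (fun n => sval (iter n lift_step (exist _ _ zero_compat))) => n /=.
by rewrite /lift_step; case: exists_lift_step.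
Qed.

Lemma sact_hom : {f : {linear Smod L -> E} |
  f snil = x0 & forall b s, f (sact b s) = r b (f s)}.
Proof.
have [g g_step] := exists_lift_approximations.
have [f fE] := Smod_lift_graded (fun n => g n.+1); exists f => [|b].
  by rewrite fE (g_step _).1.
apply: (spanning_sword (f := f \o sact b) (g := r b \o f)) => w /=.
rewrite sactE linearD sconsE !fE -sconsE (g_step _).2.
rewrite (sder_eq_on_length (f := g (size w).+1) (g := f)) ?subrK // => v vw.
by rewrite fE vw.
Qed.

End FreeLieModule.

(** * Modules over a pre-Lie algebra *)

Section PreLieModules.
Variables (k : fieldType) (L : preLieType k).

Record prelie_module := PreLieModule {
  module_space :> lmodType k;
  actl : {bilinear L -> module_space -> module_space};
  actr : {bilinear L -> module_space -> module_space};
  actr_right_symmetric : right_symmetric actr;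
  actr_actl : forall a b x, actr b (actl a x) + actl a (actl b x)
    = actl (prelie a b) x + actl a (actr b x)
}.

Definition equivariant (M N : prelie_module) (f : M -> N) : Prop :=
  (forall a x, f (actl M a x) = actl N a (f x)) /\
  (forall a x, f (actr M a x) = actr N a (f x)).

Lemma equivariant_comp (M N P : prelie_module) (f : M -> N) (g : N -> P) :
  equivariant f -> equivariant g -> equivariant (g \o f).
Proof. by move=> [fl fr] [gl gr]; split=> a x /=; rewrite ?fl ?fr ?gl ?gr. Qed.

Definition free_on (M : prelie_module) (x : M) : Prop :=
  (forall (N : prelie_module) (y : N),
     exists f : {linear M -> N}, equivariant f /\ f x = y) /\
  (forall (N : prelie_module) (f g : {linear M -> N}),
     equivariant f -> equivariant g -> f x = g x -> f =1 g).

Lemma free_on_iso (M N : prelie_module) (x : M) (y : N) :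
  free_on x -> free_on y ->
  {f : {linear M -> N} | [/\ equivariant f, f x = y & bijective f]}.
Proof.
move=> [M_hom M_ext] [N_hom N_ext]; have [f [f_eq fx]] := cid (M_hom N y).
exists f; split=> //; have [g [g_eq gy]] := N_hom M x.
have idfun_equivariant P : @equivariant P P idfun by [].
exists g.
  apply: (M_ext M (g \o f) idfun) => /=; last by rewrite fx.
  - exact: equivariant_comp.
  - exact: idfun_equivariant.
apply: (N_ext N (f \o g) idfun) => /=; last by rewrite gy.
- exact: equivariant_comp.
- exact: idfun_equivariant.
Qed.

End PreLieModules.

Section TensorWithAction.
Variables (k : fieldType) (L : preLieType k) (M : prelie_module L).
Variables (E : lmodType k) (r : {bilinear L -> E -> E}).
Hypothesis r_sym : right_symmetric r.

Lemma exists_tens_actl : {l : {bilinear L -> tens M E -> tens M E} |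
  forall a x y, l a (tpure x y) = tpure (actl M a x) y}.
Proof.
pose l a : {linear tens M E -> tens M E} :=
  tens_map (actl M a) (idfun : {linear E -> E}).
have l_linearl p : linear (fun a => l a (tpure p.1 p.2)).
  by move=> c a b; rewrite !tens_mapE /= !linearPl.
have [g gE] := spanning_bilinear (@spanning_tpure k M E) l_linearl.
by exists g => a x y; rewrite gE tens_mapE.
Qed.

Definition tens_actl : {bilinear L -> tens M E -> tens M E} :=
  sval exists_tens_actl.

Lemma tens_actlE a x y : tens_actl a (tpure x y) = tpure (actl M a x) y.
Proof. exact: (svalP exists_tens_actl). Qed.

Lemma exists_tens_actr : {R : {bilinear L -> tens M E -> tens M E} |
  forall b x y, R b (tpure x y) = tpure (actr M b x) y + tpure x (r b y)}.
Proof.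
have [f fE] : {f : L -> {linear tens M E -> tens M E} |
    forall b x y, f b (tpure x y) = tpure (actr M b x) y + tpure x (r b y)}.
  exists (fun b => tens_map (actr M b) (idfun : {linear E -> E})
    \+ tens_map (idfun : {linear M -> M}) (r b)) => b x y.
  exact: congr2 (tens_mapE _ _ _ _) (tens_mapE _ _ _ _).
have f_linearl p : linear (fun b => f b (tpure p.1 p.2)).
  by move=> c a b; rewrite !fE !linearPl linearPr scalerDr addrACA.
have [g gE] := spanning_bilinear (@spanning_tpure k M E) f_linearl.
by exists g => b x y; rewrite gE fE.
Qed.

Definition tens_actr : {bilinear L -> tens M E -> tens M E} :=
  sval exists_tens_actr.

Lemma tens_actrE b x y :
  tens_actr b (tpure x y) = tpure (actr M b x) y + tpure x (r b y).
Proof. exact: (svalP exists_tens_actr). Qed.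

Lemma tens_actr_right_symmetric : right_symmetric tens_actr.
Proof.
move=> a b; apply: (spanning_tpure
  (f := (tens_actr b \o tens_actr a) \+ tens_actr (prelie b a))
  (g := (tens_actr a \o tens_actr b) \+ tens_actr (prelie a b))) => -[x y] /=.
have expand c d :
    tens_actr d (tens_actr c (tpure x y)) + tens_actr (prelie d c) (tpure x y)
    = tpure (actr M d (actr M c x) + actr M (prelie d c) x) y
      + tpure x (r d (r c y) + r (prelie d c) y)
      + (tpure (actr M c x) (r d y) + tpure (actr M d x) (r c y)).
  rewrite !tens_actrE linearDr !tens_actrE linearDl linearDr.
  exact: (AC (2*2*2) (1*5*(4*6)*(2*3))).
by rewrite !expand actr_right_symmetric r_sym [X in _ + X]addrC.
Qed.

Lemma tens_actr_actl a b x :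
  tens_actr b (tens_actl a x) + tens_actl a (tens_actl b x)
  = tens_actl (prelie a b) x + tens_actl a (tens_actr b x).
Proof.
move: x; apply: (spanning_tpure
  (f := (tens_actr b \o tens_actl a) \+ (tens_actl a \o tens_actl b))
  (g := tens_actl (prelie a b) \+ (tens_actl a \o tens_actr b))) => -[x y] /=.
rewrite !(tens_actlE, tens_actrE) linearDr !tens_actlE addrAC -linearDl.
by rewrite actr_actl linearDl addrA.
Qed.

Definition tens_module : prelie_module L :=
  PreLieModule tens_actr_right_symmetric tens_actr_actl.

End TensorWithAction.

Section TensorAlgebraModule.
Variables (k : fieldType) (L : preLieType k).

Lemma tder_tcons_comm (a b : L) (t : Tmod L) :
  tder b (tcons a t) + tcons a (tcons b t)
  = tcons (prelie a b) t + tcons a (tder b t).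
Proof. by rewrite tder_cons addrAC subrK. Qed.

Definition T_module : prelie_module L :=
  PreLieModule (@tder_right_symmetric k L) tder_tcons_comm.

Definition TS_module : prelie_module L :=
  tens_module T_module (@sact_right_symmetric k L).

Definition TS_unit : TS_module := tpure tnil snil.

Section Action.
Variable M : prelie_module L.

Lemma exists_tact : {A : {bilinear M -> Tmod L -> M} |
  (forall x, A x tnil = x) /\ forall x a t, A x (tcons a t) = actl M a (A x t)}.
Proof.
have A x : {f : {linear Tmod L -> M} |
    f tnil = x & forall a t, f (tcons a t) = actl M a (f t)}.
  have [f f_nil f_cons] := Tmod_rec x (bilinear0 _ _ _) (actl M).
  by exists f => // a t; rewrite f_cons [LHS]add0r.
have [c x y|a t IH c x y|G GE] := Tmod_bilinear (f := fun x => s2val (A x)).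
- by rewrite !(s2valP (A _)).
- by rewrite !(s2valP' (A _)) IH linearPr.
exists G; split=> [x|x a t]; first by rewrite GE (s2valP (A x)).
by rewrite !GE (s2valP' (A x)).
Qed.

Definition tact : {bilinear M -> Tmod L -> M} := sval exists_tact.

Lemma tact_nil x : tact x tnil = x.
Proof. exact: (svalP exists_tact).1. Qed.

Lemma tact_cons x a t : tact x (tcons a t) = actl M a (tact x t).
Proof. exact: (svalP exists_tact).2. Qed.

Lemma actr_tact b x t :
  actr M b (tact x t) = tact x (tder b t) + tact (actr M b x) t.
Proof.
move: t; apply: (Tmod_ext (f := actr M b \o tact x)
  (g := (tact x \o tder b) \+ tact (actr M b x))) => /= [|a t IH].
  by rewrite tder_nil linear0 add0r !tact_nil.
rewrite tder_cons linearDr linearBr !tact_cons -addrA -linearDr -IH.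
by rewrite addrAC -actr_actl addrK.
Qed.

End Action.

Lemma TS_hom (N : prelie_module L) (y : N) :
  exists f : {linear TS_module -> N}, equivariant f /\ f TS_unit = y.
Proof.
have [psi psi_nil psi_act] := sact_hom y (@actr_right_symmetric k L N).
have tact_linearl s : linear (fun t => tact N (psi s) t) by exact: linearP.
have tact_linearr t : linear (fun s => tact N (psi s) t).
  by move=> c s s'; rewrite linearP linearPl.
have [f fE] : exists f : {linear TS_module -> N},
    forall t s, f (tpure t s) = tact N (psi s) t.
  by exists (tens_lift tact_linearl tact_linearr); apply: tens_liftE.
exists f; split; last by rewrite fE psi_nil tact_nil.
split=> a.
  apply: (spanning_tpure (f := f \o actl TS_module a) (g := actl N a \o f)).
  by move=> [t s] /=; rewrite tens_actlE !fE tact_cons.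
apply: (spanning_tpure (f := f \o actr TS_module a) (g := actr N a \o f)).
by move=> [t s] /=; rewrite tens_actrE linearD !fE psi_act actr_tact.
Qed.

Lemma TS_hom_ext (N : prelie_module L) (f g : {linear TS_module -> N}) :
  equivariant f -> equivariant g -> f TS_unit = g TS_unit -> f =1 g.
Proof.
move=> [fl fr] [gl gr] fg_unit; apply: spanning_tpure => -[t s] /=.
have fg_tnil : f \o tpure tnil =1 g \o tpure tnil.
  apply: (sact_ext (f := f \o tpure tnil) (g := g \o tpure tnil)).
    exact: fg_unit.
  move=> b s' /= fg_s.
  have tpure_sact : tpure tnil (sact b s') = actr TS_module b (tpure tnil s').
    by rewrite tens_actrE tder_nil linear0l add0r.
  by rewrite tpure_sact fr gr fg_s.
apply: (Tmod_ext (f := f \o applyr (@tpure k (Tmod L) (Smod L)) s)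
  (g := g \o applyr (@tpure k (Tmod L) (Smod L)) s)) => [|a t' /= fg_t].
  exact: fg_tnil.
have tpure_tcons : tpure (tcons a t') s = actl TS_module a (tpure t' s).
  by rewrite tens_actlE.
by rewrite tpure_tcons fl gl [f _]fg_t.
Qed.

Lemma TS_free : free_on TS_unit.
Proof. by split; [apply: TS_hom | apply: TS_hom_ext]. Qed.

End TensorAlgebraModule.

(** * The enveloping algebra as a free module *)

Section EndomorphismAlgebra.
Variables (k : fieldType) (V : lmodType k).

Definition linear_pred : {pred V -> V} := [pred f | `[< linear f >]].

Fact linear_pred_submod_closed : submod_closed linear_pred.
Proof.
split=> [|c f g]; rewrite !inE.
  by apply/asboolP => a x y; rewrite scaler0 addr0.
move=> /asboolP f_lin /asboolP g_lin; apply/asboolP=> a x y.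
by rewrite !fctE f_lin g_lin !scalerDr !scalerA (mulrC c) addrACA.
Qed.

HB.instance Definition _ := GRing.isSubmodClosed.Build k (V -> V) linear_pred
  linear_pred_submod_closed.

Variables (v0 : V).

(* An [algType] must be nontrivial, hence the nonzero vector.                *)
Record endo (v0_neq0 : v0 != 0) :=
  Endo { endo_fun :> V -> V; _ : endo_fun \in linear_pred }.

Variable v0_neq0 : v0 != 0.
Local Notation endoV := (endo v0_neq0).

HB.instance Definition _ := [isSub of endoV for @endo_fun v0_neq0].
HB.instance Definition _ := [Choice of endoV by <:].
HB.instance Definition _ := [SubChoice_isSubLmodule of endoV by <:].

Lemma endo_linear (f : endoV) : linear f.
Proof. by case: f => f f_lin; apply/asboolP. Qed.

HB.instance Definition _ (f : endoV) :=
  GRing.isLinear.Build k V V *:%R (endo_fun f) (endo_linear f).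

Definition endo_of (f : {linear V -> V}) : endoV :=
  Endo v0_neq0 (asboolT (linearP f)).
Definition endo1 : endoV := endo_of idfun.
Definition endoM (f g : endoV) : endoV := endo_of (f \o g).

Lemma endoP (f g : endoV) : f =1 g -> f = g.
Proof. by move=> fg; apply/val_inj/funext. Qed.

Fact endoMA : associative endoM.
Proof. by move=> f g h; apply: endoP. Qed.
Fact endo1M : left_id endo1 endoM.
Proof. by move=> f; apply: endoP. Qed.
Fact endoM1 : right_id endo1 endoM.
Proof. by move=> f; apply: endoP. Qed.
Fact endoMDl : left_distributive endoM +%R.
Proof. by move=> f g h; apply: endoP. Qed.
Fact endoMDr : right_distributive endoM +%R.
Proof. by move=> f g h; apply: endoP => v /=; rewrite linearD. Qed.
Fact endo1_neq0 : endo1 != 0.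
Proof.
by apply: contraNneq v0_neq0 => /(congr1 (fun f : endoV => f v0)) /= ->.
Qed.

HB.instance Definition _ := GRing.Zmodule_isNzRing.Build endoV
  endoMA endo1M endoM1 endoMDl endoMDr endo1_neq0.

Fact endoZAl (c : k) (f g : endoV) : c *: (f * g) = c *: f * g.
Proof. exact: endoP. Qed.

HB.instance Definition _ := GRing.Lmodule_isLalgebra.Build k endoV endoZAl.

Fact endoZAr (c : k) (f g : endoV) : c *: (f * g) = f * (c *: g).
Proof. by apply: endoP => v /=; rewrite linearZ_LR. Qed.

HB.instance Definition _ := GRing.Lalgebra_isAlgebra.Build k endoV endoZAr.

Definition endo_eval (v : V) (f : endoV) : V := f v.

Fact endo_eval_is_linear v : linear (endo_eval v).
Proof. by []. Qed.

HB.instance Definition _ v := GRing.isLinear.Build k endoV V *:%R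
  (endo_eval v) (endo_eval_is_linear v).

End EndomorphismAlgebra.

Section FreeAlgebraExt.
Variables (k : fieldType) (X : choiceType).

Lemma fgen_mul_word (x : X) (s : seq X) :
  fgen k x * (<< FMonom s >> : falg k X) = << FMonom (x :: s) >>.
Proof.
rewrite -[LHS]/(falg_mul _ _) falg_mul.unlock malgM_def fgmulUU mulr1.
by congr (<< _ >>); rewrite fmuE; apply: fmmulE.
Qed.

Lemma falg_linear_ext (W : lmodType k) (f g : {linear falg k X -> W}) :
  f 1 = g 1 -> (forall x u, f u = g u -> f (fgen k x * u) = g (fgen k x * u)) ->
  f =1 g.
Proof.
move=> fg1 fg_mul; apply: (@spanning_malg k {fmonom X}) => -[s].
elim: s => [|x s IH]; first by rewrite -fmoneE.
by rewrite -fgen_mul_word; apply: fg_mul.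
Qed.

End FreeAlgebraExt.

Section RegularModule.
Variables (k : fieldType) (L : preLieType k) (A : algType k) (l r : L -> A).
Hypotheses (l_linear : linear l) (r_linear : linear r).
Hypothesis rr_rel : forall a b,
  r b * r a - r (prelie a b) = r a * r b - r (prelie b a).
Hypothesis rl_rel : forall a b,
  r b * l a - l a * r b = l (prelie a b) - l a * l b.

Fact regular_linearl (f : L -> A) : linear f ->
  forall x, linear (fun a => (f a \*o @idfun A) x).
Proof. by move=> f_linear x c a b /=; rewrite f_linear mulrDl scalerAl. Qed.

Definition regular_actl : {bilinear L -> A -> A} :=
  bilinear_of (regular_linearl l_linear).
Definition regular_actr : {bilinear L -> A -> A} :=
  bilinear_of (regular_linearl r_linear).

Lemma regular_actlE a x : regular_actl a x = l a * x. Proof. by []. Qed.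
Lemma regular_actrE a x : regular_actr a x = r a * x. Proof. by []. Qed.

Lemma regular_actr_right_symmetric : right_symmetric regular_actr.
Proof.
move=> a b x; rewrite !regular_actrE !mulrA -!mulrDl; congr (_ * _).
exact/subr_eq_sub/rr_rel.
Qed.

Lemma regular_actr_actl a b x :
  regular_actr b (regular_actl a x) + regular_actl a (regular_actl b x)
  = regular_actl (prelie a b) x + regular_actl a (regular_actr b x).
Proof.
rewrite !(regular_actlE, regular_actrE) !mulrA -!mulrDl; congr (_ * _).
exact/subr_eq_sub/rl_rel.
Qed.

Definition regular_module : prelie_module L :=
  PreLieModule regular_actr_right_symmetric regular_actr_actl.

End RegularModule.

Section EnvelopingModule.
Variables (k : fieldType) (L : preLieType k).
Local Notation U := (UPreLie L).

Definition UPreLie_module : prelie_module L :=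
  regular_module (@Ul_linear k L) (@Ur_linear k L) (@Urr k L) (@Url k L).

Lemma UPreLie_hom (N : prelie_module L) (y : N) :
  exists f : {linear UPreLie_module -> N}, equivariant f /\ f (1 : U) = y.
Proof.
have [->|y_neq0] := eqVneq y 0.
  by exists \0; split=> //; split=> a x; rewrite linear0.
pose l a := endo_of y_neq0 (actl N a); pose r a := endo_of y_neq0 (actr N a).
have l_linear : linear l by move=> c a b; apply: endoP => x; apply: linearPl.
have r_linear : linear r by move=> c a b; apply: endoP => x; apply: linearPl.
have rr_rel a b : r b * r a - r (prelie a b) = r a * r b - r (prelie b a).
  by apply/subr_eq_sub/endoP => x; apply: actr_right_symmetric.
have rl_rel a b : r b * l a - l a * r b = l (prelie a b) - l a * l b.
  by apply/subr_eq_sub/endoP => x; apply: actr_actl.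
pose rho := U_lift l_linear r_linear rr_rel rl_rel.
exists (endo_eval y \o rho); split; last by rewrite /= rmorph1.
split=> a x /=.
  by rewrite rmorphM /= U_lift_l.
by rewrite rmorphM /= U_lift_r.
Qed.

Lemma UPreLie_linear_ext (W : lmodType k) (f g : {linear U -> W}) : f 1 = g 1 ->
  (forall a u, f u = g u -> f (Ul a * u) = g (Ul a * u)) ->
  (forall a u, f u = g u -> f (Ur a * u) = g (Ur a * u)) -> f =1 g.
Proof.
move=> fg1 fgl fgr x; have [u ->] := lproj_surj x.
pose p := lproj (ideal (@UPreLie_rel k L)).
apply: (falg_linear_ext (f := f \o p) (g := g \o p)) => [|y v] /=.
  exact: fg1.
by rewrite -UmulrE; case: y => a; [apply: fgl | apply: fgr].
Qed.

Lemma UPreLie_hom_ext (N : prelie_module L)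
    (f g : {linear UPreLie_module -> N}) :
  equivariant f -> equivariant g -> f (1 : U) = g (1 : U) -> f =1 g.
Proof.
move=> [fl fr] [gl gr] fg1; apply: UPreLie_linear_ext => // a u fg_u.
  by rewrite [LHS](fl a u) [RHS](gl a u) fg_u.
by rewrite [LHS](fr a u) [RHS](gr a u) fg_u.
Qed.

Lemma UPreLie_free : @free_on k L UPreLie_module 1.
Proof. by split; [apply: UPreLie_hom | apply: UPreLie_hom_ext]. Qed.

End EnvelopingModule.

(** * Naturality *)

Section RestrictionOfScalars.
Variables (k : fieldType) (L L' : preLieType k) (f : preLieHom L L').
Variable M : prelie_module L'.

Fact restrict_linearl (act : {bilinear L' -> M -> M}) x :
  linear (fun a => act (f a) x).
Proof. by move=> c a b; rewrite linearP linearPl. Qed.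

Definition restrict_actl : {bilinear L -> M -> M} :=
  bilinear_of (restrict_linearl (actl M)).
Definition restrict_actr : {bilinear L -> M -> M} :=
  bilinear_of (restrict_linearl (actr M)).

Lemma restrict_actr_right_symmetric : right_symmetric restrict_actr.
Proof.
by move=> a b x; rewrite /= /bilinear_of !plhomM; apply: actr_right_symmetric.
Qed.

Lemma restrict_actr_actl a b x :
  restrict_actr b (restrict_actl a x) + restrict_actl a (restrict_actl b x)
  = restrict_actl (prelie a b) x + restrict_actl a (restrict_actr b x).
Proof. by rewrite /= /bilinear_of !plhomM; apply: actr_actl. Qed.

Definition restrict_module : prelie_module L :=
  PreLieModule restrict_actr_right_symmetric restrict_actr_actl.

End RestrictionOfScalars.

Definition equivariant_along (k : fieldType) (L L' : preLieType k)
    (f : preLieHom L L') (M : prelie_module L) (N : prelie_module L')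
    (g : M -> N) : Prop :=
  (forall a x, g (actl M a x) = actl N (f a) (g x)) /\
  (forall a x, g (actr M a x) = actr N (f a) (g x)).

Lemma free_on_natural (k : fieldType) (L L' : preLieType k) (f : preLieHom L L')
    (M N : prelie_module L) (M' N' : prelie_module L') (x : M)
    (phi : {linear M -> N}) (phi' : {linear M' -> N'})
    (g : {linear M -> M'}) (h : {linear N -> N'}) :
  free_on x -> equivariant phi -> equivariant phi' ->
  equivariant_along f g -> equivariant_along f h ->
  phi' (g x) = h (phi x) -> forall y, phi' (g y) = h (phi y).
Proof.
move=> [_ M_ext] [phil phir] [phi'l phi'r] [gl gr] [hl hr].
apply: (M_ext (restrict_module f N') (phi' \o g) (h \o phi)).
  by split=> a y /=; [rewrite gl phi'l | rewrite gr phi'r].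
by split=> a y /=; [rewrite phil hl | rewrite phir hr].
Qed.

Section Naturality.
Variables (k : fieldType) (L L' : preLieType k) (f : preLieHom L L').

Lemma UPreLie_map_equivariant :
  equivariant_along f (M := UPreLie_module L) (N := UPreLie_module L')
    (UPreLie_map f).
Proof.
split=> a u; rewrite [LHS]rmorphM; congr (_ * _).
  exact: UPreLie_map_l.
exact: UPreLie_map_r.
Qed.

Lemma Tmod_map_tder b t : Tmod_map f (tder b t) = tder (f b) (Tmod_map f t).
Proof.
move: (Tmod_map f) (Tmod_map_tnil f) (Tmod_map_tcons f) t => F F_nil F_cons.
apply: (Tmod_ext (f := F \o tder b) (g := tder (f b) \o F)) => [|a t] /=.
  by rewrite F_nil !tder_nil linear0.
by rewrite !(tder_cons, F_cons) linearD linearB !F_cons plhomM => ->.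
Qed.

Lemma Smod_map_sact b s : Smod_map f (sact b s) = sact (f b) (Smod_map f s).
Proof.
move: (Smod_map f) (Smod_map_snil f) (Smod_map_scons f) s => F F_nil F_cons.
apply: (Smod_ext (f := F \o sact b) (g := sact (f b) \o F)) => [|a s] /=.
  by rewrite F_nil !sact_nil F_cons F_nil.
by rewrite !(sact_cons, F_cons) linearD !F_cons plhomM => ->.
Qed.

Lemma TS_map_equivariant :
  equivariant_along f (M := TS_module L) (N := TS_module L')
    (tens_map (Tmod_map f) (Smod_map f)).
Proof.
have := tens_mapE (Tmod_map f) (Smod_map f).
move: (tens_map _ _) => F F_pure; split=> a.
  apply: (spanning_tpure (f := F \o actl (TS_module L) a)
    (g := actl (TS_module L') (f a) \o F)) => -[t s] /=.
  by rewrite !(tens_actlE, F_pure) -Tmod_map_tcons.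
apply: (spanning_tpure (f := F \o actr (TS_module L) a)
  (g := actr (TS_module L') (f a) \o F)) => -[t s] /=.
by rewrite !(tens_actrE, F_pure) linearD !F_pure -Tmod_map_tder -Smod_map_sact.
Qed.

Lemma TS_map_unit :
  tens_map (Tmod_map f) (Smod_map f) (TS_unit L) = TS_unit L'.
Proof. by rewrite tens_mapE Tmod_map_tnil Smod_map_snil. Qed.

End Naturality.

Lemma UPreLie_TS_iso (k : fieldType) (L : preLieType k) :
  {phi : {linear UPreLie L -> tens (Tmod L) (Smod L)} |
    [/\ @equivariant k L (UPreLie_module L) (TS_module L) phi,
        phi 1 = tpure tnil snil & bijective phi]}.
Proof. exact: free_on_iso (@UPreLie_free k L) (@TS_free k L). Qed.

Theorem theorem2 (k : fieldType) (char0 : [pchar k] =i pred0) :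
  exists phi : forall L : preLieType k,
      {linear UPreLie L -> tens (Tmod L) (Smod L)},
    (forall L : preLieType k, bijective (phi L)) /\
    (forall (L L' : preLieType k) (f : preLieHom L L') (u : UPreLie L),
        phi L' (UPreLie_map f u)
        = tens_map (Tmod_map f) (Smod_map f) (phi L u)).
Proof.
pose phi L := sval (@UPreLie_TS_iso k L).
have phiP L := svalP (@UPreLie_TS_iso k L).
exists phi; split=> [L|L L' f]; first by case: (phiP L).
have [[phi_eq phi1 _] [phi'_eq phi'1 _]] := (phiP L, phiP L').
apply: (free_on_natural (@UPreLie_free k L) phi_eq phi'_eq
  (UPreLie_map_equivariant f) (TS_map_equivariant f)).
by rewrite rmorph1 phi'1 phi1 [RHS]TS_map_unit.
Qed.
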